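(* (i) Let $\mu\in{\cal P}(2)$ with $|\mu|=k$, and let $n\geq k$. For $\tau\in{\cal P}(2,n)$, $$d^\tau_\mu(2n)=\begin{cases}0&\text{if }|\tau|>k,\\ 0&\text{if }|\tau|=k\text{ and }\tau\neq\mu,\\ 2^{\ell(\mu)}&\text{if }\tau=\mu.\end{cases}$$ If $|\tau|=j<k$, then $$d^\tau_\mu(2n)=\sum_{r=j\vee\lfloor\frac{k+1}{2}\rfloor}^{k-1}\left\{\sum_{s=j\vee\lfloor\frac{k+1}{2}\rfloor}^{r}(-1)^{r-s}\binom{r-j}{s-j}\,m\big((\mu,1^{2s-k}),2(\tau,1^{s-j})\big)\right\}\binom{n-j}{r-j}.$$ (ii) The set $\{f(\mu,2n):\mu\in{\cal P}(2,n)\}$ is a basis of ${\cal B}_{2n}$.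
   Context: Let $K_{2n}$ be the complete graph on $\{1,\ldots,2n\}$, ${\cal M}_{2n}$ its set of perfect matchings, and $[i,j]$ the edge joining $i,j$. For $A,B\in{\cal M}_{2n}$, $d(A,B)$ is the partition of $2n$ whose parts are the numbers of vertices of the connected components of the spanning subgraph with edge set $A\cup B$; it has the form $2\nu$ with $\nu\vdash n$. The group $S_{2n}$ acts on ${\mathbb C}[{\cal M}_{2n}]$ by relabelling vertices. For $\nu\vdash n$, $N_{2\nu}(A)=\sum_{B:\,d(A,B)=2\nu}B$, and these operators form a basis of ${\cal B}_{2n}=\mathrm{End}_{S_{2n}}({\mathbb C}[{\cal M}_{2n}])$. ${\cal P}(2)$ is the set of partitions all of whose parts are $\geq 2$; it includes the empty partition $(0)$ of $0$. ${\cal P}(2,n)=\{\tau\in{\cal P}(2):|\tau|\leq n\}$, and $\ell(\mu)$ is the number of parts of $\mu$. For a partition $\mu$ and $m\geq|\mu|$, $(\mu,1^{m-|\mu|})$ is the partition of $m$ obtained by appending $m-|\mu|$ parts equal to $1$. For $\tau\in{\cal P}(2)$, $M_{2\tau}(2n)=N_{2(\tau,1^{n-|\tau|})}$ if $n\geq|\tau|$ and $M_{2\tau}(2n)=0$ otherwise. For $\mu\in{\cal P}(2)$ and $m\geq1$, $c_\mu(m)\in{\mathbb C}[S_m]$ is the sum of all permutations whose cycles of length $\geq2$ have lengths given by $\mu$; it is $0$ if $m<|\mu|$. Then $f(\mu,2n)\in{\cal B}_{2n}$ is the operator $x\mapsto c_\mu(2n)\cdot x$ on ${\mathbb C}[{\cal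 M}_{2n}]$. The integers $d^\tau_\mu(2n)$ are defined by the expansion $f(\mu,2n)=\sum_{\tau\in{\cal P}(2,n)}d^\tau_\mu(2n)M_{2\tau}(2n)$. Let $I=\{[1,n+1],\ldots,[n,2n]\}$ in ${\cal M}_{2n}$, and more generally $I_s=\{[1,s+1],\ldots,[s,2s]\}\in{\cal M}_{2s}$. For $\rho\vdash 2s$ and $\sigma\vdash s$, $m(\rho,2\sigma)$ is the number of permutations in $S_{2s}$ of cycle type $\rho$ sending $I_s$ to a fixed $A\in{\cal M}_{2s}$ with $d(I_s,A)=2\sigma$; this is independent of the choice of $A$. Finally, $a\vee b=\max(a,b)$. *)

(* Defs.v *)
From mathcomp Require Import all_boot all_algebra all_fingroup.
From mathcomp Require Import complex reals.

Set Implicit Arguments.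
Unset Strict Implicit.
Unset Printing Implicit Defensive.

Import GRing.Theory.
Local Open Scope ring_scope.

(* Partitions are represented as nonincreasing sequences of positive nats. *)

Definition isP2 (mu : seq nat) : bool :=
  sorted geq mu && all (fun x => 1 < x)%N mu.

Fixpoint words (k b : nat) : seq (seq nat) :=
  if k is k'.+1 then [seq x :: w | x <- iota 0 b.+1, w <- words k' b]
  else [:: [::]].

Definition P2_enum (n : nat) : seq (seq nat) :=
  undup [seq w <- flatten [seq words k n | k <- iota 0 n.+1]
        | isP2 w && (sumn w <= n)%N].

Definition pad (mu : seq nat) (m : nat) : seq nat := mu ++ nseq (m - sumn mu) 1%N.

Definition double (nu : seq nat) : seq nat := [seq (2 * x)%N | x <- nu].

Definition is_pm (m : nat) (A : {set {set 'I_m}}) : bool :=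
  [forall e in A, #|e| == 2%N] && [forall x, #|[set e in A | x \in e]| == 1%N].

Definition matching (m : nat) := {A : {set {set 'I_m}} | is_pm A}.

Definition mact_raw (m : nat) (s : {perm 'I_m}) (A : {set {set 'I_m}}) :
  {set {set 'I_m}} := [set s @: (e : {set 'I_m}) | e in A].

Definition mact (m : nat) (s : {perm 'I_m}) (A : matching m) : matching m :=
  insubd A (mact_raw s (val A)).

Definition union_rel (m : nat) (A B : {set {set 'I_m}}) : rel 'I_m :=
  fun x y => [exists e, ((e \in A) || (e \in B)) && (x \in e) && (y \in e)].

Definition components (m : nat) (A B : {set {set 'I_m}}) : {set {set 'I_m}} :=
  [set [set y | connect (union_rel A B) x y] | x : 'I_m].

Definition dist_raw (m : nat) (A B : {set {set 'I_m}}) : seq nat :=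
  sort geq [seq #|(C : {set 'I_m})| | C <- enum (components A B)].

Definition dist (m : nat) (A B : matching m) : seq nat := dist_raw (val A) (val B).

Definition ctype (m : nat) (s : {perm 'I_m}) : seq nat :=
  sort geq [seq #|(C : {set 'I_m})| | C <- enum (porbits s)].

(* The space C[M_2n] and operators on it.  A vector x is its coefficient  *)
(* function: x = \sum_A x(A) A.                                            *)

Section Ops.
Variable R : realType.
Notation C := (R[i]).

Definition vec (n : nat) := {ffun matching n.*2 -> C}.

(* action of S_2n on C[M_2n]: sigma . (\sum_A x(A) A) = \sum_A x(A) (sigma . A) *)
Definition vact (n : nat) (s : {perm 'I_(n.*2)}) (x : vec n) : vec n :=
  [ffun B => \sum_(A | mact s A == B) x A].

(* N_{2nu}: A |-> \sum_{B : d(A,B) = 2 nu} B, extended linearly *)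
Definition N_op (n : nat) (nu : seq nat) (x : vec n) : vec n :=
  [ffun B => \sum_(A | dist A B == double nu) x A].

Definition M_op (n : nat) (tau : seq nat) (x : vec n) : vec n :=
  if (sumn tau <= n)%N then @N_op n (pad tau n) x else 0.

(* f(mu,2n): x |-> c_mu(2n) . x, c_mu(2n) = sum of the permutations whose
   cycles of length >= 2 have lengths mu, i.e. of cycle type (mu,1^(2n-|mu|)) *)
Definition f_op (n : nat) (mu : seq nat) (x : vec n) : vec n :=
  \sum_(s : {perm 'I_(n.*2)} | ctype s == pad mu n.*2) vact s x.

End Ops.

Arguments vact {R} n s x.
Arguments N_op {R} n nu x.
Arguments M_op {R} n tau x.
Arguments f_op {R} n mu x.

(* I_s = {[1,s+1],...,[s,2s]} (vertices numbered from 0 here) *)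
Definition I_raw (s : nat) : {set {set 'I_(s.*2)}} :=
  [set e : {set 'I_(s.*2)} |
     [exists i : 'I_s, e == [set x : 'I_(s.*2) | (val x == val i) || (val x == s + val i)%N]]].

(* m(rho, 2 sigma): number of permutations in S_2s of cycle type rho sending
   I_s to a fixed A with d(I_s, A) = 2 sigma (independent of the choice of A) *)
Definition mcount (s : nat) (rho sigma : seq nat) : nat :=
  match [pick A : matching s.*2 | dist_raw (I_raw s) (val A) == double sigma] with
  | Some A => #|[set g : {perm 'I_(s.*2)} |
                  (ctype g == rho) && (mact_raw g (I_raw s) == val A)]|
  | None => 0%N
  end.

Definition dcoef (R : realType) (mu : seq nat) (n : nat) (tau : seq nat) : R[i] :=
  let k := sumn mu in
  let j := sumn tau in
  let lo := maxn j (k.+1)./2 in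
  if (k < j)%N then 0
  else if j == k then (if tau == mu then 2 ^+ size mu else 0)
  else \sum_(lo <= r < k)
         (\sum_(lo <= s < r.+1)
            (-1) ^+ (r - s) * ('C(r - j, s - j))%:R
              * (mcount s (pad mu s.*2) (pad tau s))%:R)
         * ('C(n - j, r - j))%:R.

(* Main.v *)
Require Import Defs.
From mathcomp Require Import all_boot all_algebra all_fingroup.
From mathcomp Require Import complex reals.
From mathcomp Require Import zify.
Import GRing.Theory.
Local Open Scope ring_scope.

(* A perfect matching is a fixed-point-free involution.  If a and b are the
   involutions of A and B, the components of the union of A and B are the sets
   O :|: a @: O with O a cycle of a * b, and a @: O is another cycle of the same
   length, so d(A, B) records the cycle type of a * b.  Two pairs with the same
   d are simultaneously conjugate, hence an operator commuting with S_2n is a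
   function of d, and the coefficient of M_2tau in f(mu, 2n) is the number of
   permutations g of type mu with g A = B, where d(A, B) = 2(tau, 1^(n-j)).
   The set of edges of A that g moves contains the j edges of A not in B; it has
   at least k/2 elements, and fewer than k when j < k.  The g moving only edges
   in a given set of s edges are counted by m, and the formula is the binomial
   inversion of this count.  When j = k, g agrees with a * b on its support,
   which is one of the two cycles of each nontrivial component: this gives
   2^l(mu).  Triangularity of the coefficients in |tau| then yields (ii). *)

Set Implicit Arguments.
Unset Strict Implicit.
Unset Printing Implicit Defensive.

Local Open Scope nat_scope.

(** * Block sizes of a partition *)

Lemma geq_trans : transitive geq.
Proof. by move=> y x z /= h1 h2; apply: leq_trans h2 h1. Qed.

Lemma geq_anti : antisymmetric geq.
Proof. by move=> x y /andP[h1 h2]; apply/eqP; rewrite eqn_leq; apply/andP. Qed.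

Lemma geq_total : total geq.
Proof. by move=> x y; rewrite /geq /= leq_total. Qed.

Lemma sorted_geq_eq (s t : seq nat) :
  sorted geq s -> sorted geq t -> (forall k, count_mem k s = count_mem k t) -> s = t.
Proof.
move=> ss st h; apply: (sorted_eq geq_trans geq_anti ss st).
by apply/allP=> x _; rewrite /= h.
Qed.

Lemma sumn_all_eq (u : nat) (s : seq nat) : all (pred1 u) s -> sumn s = u * size s.
Proof. by move/all_pred1P=> ->; rewrite sumn_nseq size_nseq. Qed.

Lemma sorted_geq_nseq (s : seq nat) (u n : nat) :
  sorted geq s -> all (leq u) s -> sorted geq (s ++ nseq n u).
Proof.
rewrite !(sorted_pairwise geq_trans) pairwise_cat => -> /allP h.
apply/and3P; split=> //.
  by apply/allrelP=> x y xs /nseqP[-> _]; apply: h.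
elim: n => //= n ->; rewrite andbT; apply/allP=> x /nseqP[-> _] /=; exact: leqnn.
Qed.

Section Blocks.
Variables (T : finType) (f : T -> {set T}).
(** Under these two hypotheses [f x] is the block of [x] in a partition of [T]; the instances are
    cycles of a permutation and components of a union of matchings. *)
Hypothesis fx : forall x, x \in f x.
Hypothesis fe : forall x y, y \in f x -> f y = f x.

(** The cutoff [u] is the size of a trivial block: 1 for cycles, 2 for components. *)
Definition bsizes (u : nat) : seq nat :=
  sort geq [seq #|(C : {set T})| | C <- enum [set f x | x : T] & u < #|(C : {set T})|].

Lemma bsizes_sorted u : sorted geq (bsizes u).
Proof. exact: (sort_sorted geq_total). Qed.

Lemma blockE x y : (f x == f y) = (x \in f y).
Proof. by apply/eqP/idP => [<-|/fe]. Qed.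

Lemma count_blocks (p : pred nat) :
  \sum_(C in [set f x | x : T] | p #|C|) #|C| = #|[set x | p #|f x|]|.
Proof.
rewrite -sum1_card.
rewrite (partition_big f (fun C => (C \in [set f x | x : T]) && p #|C|)) /=; last first.
  by move=> x; rewrite inE imset_f.
apply: eq_bigr => C /andP[/imsetP[y _ ->] pC].
rewrite -sum1_card; apply: eq_bigl => x; rewrite inE blockE.
by case h : (x \in f y); rewrite ?andbF // (fe h) pC.
Qed.

Lemma sumn_bsizes u : sumn (bsizes u) = #|[set x | u < #|f x|]|.
Proof.
rewrite -(count_blocks (leq u.+1)) /bsizes sumnE.
rewrite (perm_big [seq #|(C : {set T})| | C <- enum [set f x | x : T] & u < #|(C : {set T})|]);
  last by rewrite perm_sort.
by rewrite big_map big_filter big_enum_cond.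
Qed.

(** Points are counted in place of blocks, each block of size [k] contributing [k] points: sets of
    points are easy to transport and no division occurs. *)
Lemma count_bsizes u k :
  count_mem k (bsizes u) * k = if u < k then #|[set x | #|f x| == k]| else 0.
Proof.
rewrite /bsizes; have /seq.permP -> := permEl (perm_sort geq
  [seq #|(C : {set T})| | C <- enum [set f x | x : T] & u < #|(C : {set T})|]).
rewrite count_map count_filter; case: ltnP => uk; last first.
  rewrite (@eq_count _ _ pred0) ?count_pred0 // => C /=.
  by case: eqP => //= ->; rewrite ltnNge uk.
rewrite -[RHS](count_blocks (pred1 k)).
rewrite (eq_bigr (fun=> k)); last by move=> C /andP[_ /eqP].
rewrite sum_nat_cond_const; congr (_ * _).
rewrite cardE /enum_mem size_filter count_filter.
apply: eq_count => C /=; rewrite !inE.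
by case: eqP => /= [->|]; rewrite ?uk ?andbT ?andbF.
Qed.

Lemma mem_bsizes u k : k \in bsizes u -> u < k.
Proof. by rewrite mem_sort => /mapP[C]; rewrite mem_filter => /andP[h _] ->. Qed.

(** The blocks removed by the cutoff all have size exactly [u], and their number is forced by the
    total [#|T|]. *)
Lemma blocks_pad (u : nat) : 0 < u -> (forall x, u <= #|f x|) ->
  sort geq [seq #|(C : {set T})| | C <- enum [set f x | x : T]]
  = bsizes u ++ nseq ((#|T| - sumn (bsizes u)) %/ u) u.
Proof.
move=> u0 hu; set S := [set f x | x : T].
set L := sort _ _.
have E : perm_eq L (bsizes u ++ [seq #|(C : {set T})| | C <- enum S & ~~ (u < #|(C : {set T})|)]).
  rewrite /L perm_sort /bsizes.
  apply: (@perm_trans _ (map (fun C : {set T} => #|C|) (filter (fun C : {set T} => u < #|C|) (enum S) ++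
     filter (fun C : {set T} => ~~ (u < #|C|)) (enum S)))).
    by apply: perm_map; rewrite perm_sym; apply/permPl/perm_filterC.
  by rewrite map_cat perm_cat2r perm_sym perm_sort.
have E2 : all (pred1 u) [seq #|(C : {set T})| | C <- enum S & ~~ (u < #|(C : {set T})|)].
  apply/allP => k /mapP[C]; rewrite mem_filter mem_enum -leqNgt => /andP[h1 /imsetP[x _ e]] ->.
  by rewrite /= eqn_leq h1 e hu.
have E3 : sumn L = #|T|.
  rewrite /L sumnE (perm_big [seq #|(C : {set T})| | C <- enum S]); last by rewrite perm_sort.
  rewrite big_map big_enum /=.
  have := count_blocks predT; rewrite (eq_bigl (fun C => C \in S)); last by move=> C; rewrite andbT.
  by move=> ->; apply: eq_card => x; rewrite inE.
have E4 := perm_sumn E; rewrite sumn_cat (sumn_all_eq E2) E3 in E4.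
apply: (sorted_eq geq_trans geq_anti).
- exact: (sort_sorted geq_total).
- apply: sorted_geq_nseq; first exact: bsizes_sorted.
  by apply/allP => x /mem_bsizes /ltnW.
move/all_pred1P: E2 => E2; rewrite E2 in E.
by rewrite E4 addKn mulKn.
Qed.

End Blocks.

(** * Cycle types and pairs of fixed-point-free involutions *)

Lemma filter_pad (mu : seq nat) m : isP2 mu -> [seq k <- pad mu m | 1 < k] = mu.
Proof.
case/andP=> _ h; rewrite filter_cat (all_filterP h) -[RHS]cats0; congr (_ ++ _).
by elim: (m - _).
Qed.

Lemma map_double_inj : injective Defs.double.
Proof. by apply: (@inj_map _ _ (muln 2)) => x y /eqP; rewrite eqn_pmul2l // => /eqP. Qed.

Lemma doubleP2E (mu nu : seq nat) m : isP2 mu -> isP2 nu ->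
  (Defs.double (pad mu m) == Defs.double (pad nu m)) = (mu == nu).
Proof.
move=> h1 h2; rewrite (inj_eq map_double_inj); apply/eqP/eqP => [e|->] //.
by rewrite -(filter_pad m h1) e filter_pad.
Qed.

Definition cycle_points (T : finType) (g : {perm T}) (k : nat) : nat :=
  #|[set x | #|porbit g x| == k]|.

(** The cycle type with fixed points left out, hence an element of P(2). *)
Definition ntype (T : finType) (g : {perm T}) : seq nat := bsizes (porbit g) 1.

Section Ntype.
Variables (T : finType) (g : {perm T}).

Lemma porbit_eq x y : y \in porbit g x -> porbit g y = porbit g x.
Proof. by rewrite -eq_porbit_mem => /eqP. Qed.

Lemma card_porbit_gt0 x : 0 < #|porbit g x|.
Proof. by rewrite lt0n card_porbit_neq0. Qed.

Lemma card_porbit_gt1 x : (1 < #|porbit g x|) = (g x != x).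
Proof.
apply/idP/idP => [h|gx].
  apply/eqP => e; move: h; rewrite ltnNge => /negP; apply.
  rewrite -(cards1 x); apply/subset_leq_card/subsetP => y /porbitP[i ->].
  by rewrite inE permX; elim: i => //= i /eqP ->; rewrite e.
have <- : #|[set g x; x]| = 2 by rewrite cards2 gx.
apply/subset_leq_card/subsetP => y; rewrite !inE => /orP[]/eqP->; last exact: porbit_id.
exact: (mem_porbit g 1).
Qed.

Lemma ntype_P2 : isP2 (ntype g).
Proof.
by rewrite /isP2 bsizes_sorted; apply/allP => k /mem_bsizes.
Qed.

Lemma sumn_ntype : sumn (ntype g) = #|[set x | g x != x]|.
Proof.
rewrite /ntype sumn_bsizes; [|exact: porbit_id|exact: porbit_eq].
by apply: eq_card => x; rewrite !inE card_porbit_gt1.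
Qed.

Lemma count_ntype k : 1 < k -> count_mem k (ntype g) * k = cycle_points g k.
Proof.
by move=> hk; rewrite /ntype count_bsizes ?hk //; [exact: porbit_id|exact: porbit_eq].
Qed.

End Ntype.

Lemma P2_eq (mu nu : seq nat) : isP2 mu -> isP2 nu ->
  (forall k, 1 < k -> count_mem k mu = count_mem k nu) -> mu = nu.
Proof.
move=> /andP[s1 /allP a1] /andP[s2 /allP a2] h; apply: sorted_geq_eq => // k.
case: (ltnP 1 k) => [/h //|k1].
by rewrite !(count_memPn _) //; apply/negP; [move/a2|move/a1] => /=; rewrite ltnNge k1.
Qed.

Lemma ntype_eqP (T : finType) (g : {perm T}) mu : isP2 mu ->
  (ntype g = mu) <-> (forall k, 1 < k -> cycle_points g k = count_mem k mu * k).
Proof.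
move=> hmu; split=> [<- k hk|h]; first by rewrite count_ntype.
apply: P2_eq => [|//|k hk]; first exact: ntype_P2.
by apply/eqP; rewrite -(eqn_pmul2r (ltnW hk)) count_ntype // h.
Qed.

Lemma ctypeE m (g : {perm 'I_m}) : ctype g = pad (ntype g) m.
Proof.
rewrite /ctype /porbits.
rewrite (@blocks_pad _ (porbit g) (@porbit_id _ g) (@porbit_eq _ g) 1) //.
  by rewrite card_ord divn1.
exact: card_porbit_gt0.
Qed.

Lemma ctype_eq m (g : {perm 'I_m}) mu : isP2 mu ->
  (ctype g == pad mu m) = (ntype g == mu).
Proof.
move=> h; rewrite ctypeE; apply/eqP/eqP => [e|->] //.
by rewrite -(filter_pad m (ntype_P2 g)) e filter_pad.
Qed.

(** * Fixed-point-free involutions and the dihedral group of a pair *)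

Definition fpf (T : finType) (a : {perm T}) : bool :=
  [forall x, (a (a x) == x) && (a x != x)].

Lemma fpfK (T : finType) (a : {perm T}) : fpf a -> involutive a.
Proof. by move=> /forallP h x; have /andP[/eqP] := h x. Qed.

Lemma fpf_neq (T : finType) (a : {perm T}) x : fpf a -> a x != x.
Proof. by move=> /forallP /(_ x) /andP[]. Qed.

Lemma fpfJ (T : finType) (a g : {perm T}) : fpf a -> fpf (a ^ g).
Proof.
move=> ha; apply/forallP => x; rewrite -(permKV g x) !permJ.
by rewrite (fpfK ha) eqxx (inj_eq perm_inj) fpf_neq.
Qed.

(** For involutions, this is the orbit of [x] under the group generated by [a] and [b]. *)
Definition ucomp (T : finType) (a b : {perm T}) (x : T) : {set T} :=
  porbit (a * b) x :|: porbit (a * b) (a x).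

(** The cutoff 2 discards the edges common to both matchings; after halving, what remains is the
    [tau] in P(2) with [d(A,B) = 2(tau,1^(n-|tau|))]. *)
Definition dtype (T : finType) (a b : {perm T}) : seq nat :=
  [seq k./2 | k <- bsizes (ucomp a b) 2].

Section Dihedral.
Variables (T : finType) (a b : {perm T}).
Hypotheses (ha : fpf a) (hb : fpf b).
Let c := (a * b)%g.
Let aK := fpfK ha.
Let bK := fpfK hb.

(** Conjugation by [a] turns [a * b] into [b * a], the inverse of [a * b]. Hence [a] carries cycles
    of [c] to cycles of [c]. *)
Lemma fpf_conj_prod : (c ^ a = c^-1)%g.
Proof.
apply/permP => x; rewrite -[x in LHS]aK permJ; apply: (can_inj (permK c)).
by rewrite permKV /c !permM aK bK aK.
Qed.

Lemma fpf_porbit_sub x y : y \in porbit c x -> a y \in porbit c (a x).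
Proof.
case/porbitP=> i ->; rewrite -permJ conjXg fpf_conj_prod expgVn -expgVn.
by rewrite -porbitV mem_porbit.
Qed.

Lemma fpf_porbit x y : (a y \in porbit c (a x)) = (y \in porbit c x).
Proof.
by apply/idP/idP => /fpf_porbit_sub //; rewrite !aK.
Qed.

Lemma card_fpf_porbit x : #|porbit c (a x)| = #|porbit c x|.
Proof.
rewrite -[RHS](card_imset _ (can_inj aK)); apply: eq_card => y.
by rewrite -[y]aK fpf_porbit (mem_imset _ _ (can_inj aK)).
Qed.

(* Depending on the parity of [i], [a x = c ^ i x] gives a fixed point of [a] or of [b]. *)
Lemma fpf_porbit_notin x : a x \notin porbit c x.
Proof.
apply/negP; case/porbitP=> i.
have cm j y : a ((c ^+ j)%g y) = (c ^- j)%g (a y).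
  by rewrite -permJ conjXg fpf_conj_prod expgVn.
rewrite -(odd_double_half i) -addnn addnA expgD permM; set l := i./2.
move/(congr1 (c ^- l)%g); rewrite permK -cm.
case: (odd i); rewrite ?add0n ?add1n.
  rewrite expgSr permM; move: ((c ^+ l)%g x) => y; rewrite permM => e.
  by have := fpf_neq (a y) hb; rewrite -e eqxx.
by move=> e; have := fpf_neq ((c ^+ l)%g x) ha; rewrite e eqxx.
Qed.

Lemma ucomp_id x : x \in ucomp a b x.
Proof. by rewrite inE porbit_id. Qed.

Lemma ucompa x : ucomp a b (a x) = ucomp a b x.
Proof. by rewrite /ucomp aK setUC. Qed.

Lemma ucomp_porbit x y : y \in porbit c x -> ucomp a b y = ucomp a b x.
Proof.
move=> h; rewrite /ucomp (porbit_eq h); congr (_ :|: _).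
by apply: porbit_eq; rewrite fpf_porbit.
Qed.

Lemma ucompE x y : y \in ucomp a b x -> ucomp a b y = ucomp a b x.
Proof. by rewrite inE => /orP[] /ucomp_porbit ->; rewrite ?ucompa. Qed.

Lemma ucompb x : ucomp a b (b x) = ucomp a b x.
Proof.
rewrite -[x in LHS]aK -permM -(ucompa x); apply: ucomp_porbit.
exact: (mem_porbit c 1).
Qed.

Lemma card_ucomp x : #|ucomp a b x| = #|porbit c x|.*2.
Proof.
rewrite cardsU card_fpf_porbit -addnn -[RHS]subn0; congr (_ - _).
apply/eqP; rewrite cards_eq0 -subset0; apply/subsetP => y; rewrite !inE.
case/andP=> /porbit_eq h1 /porbit_eq h2.
by have := fpf_porbit_notin x; rewrite -h1 h2 porbit_id.
Qed.

Lemma dtype_P2 : isP2 (dtype a b).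
Proof.
have h2 k : k \in bsizes (ucomp a b) 2 -> exists2 l, k = l.*2 & 1 < l.
  rewrite mem_sort => /mapP[C]; rewrite mem_filter => /andP[h].
  rewrite mem_enum => /imsetP[x _ e] ->; exists #|porbit c x|.
    by rewrite e card_ucomp.
  by move: h; rewrite e card_ucomp; lia.
rewrite /isP2; apply/andP; split.
  apply: (homo_sorted (e := geq)); last exact: bsizes_sorted.
  by move=> x y; exact: half_leq.
by apply/allP => k /mapP[l /h2[m -> h] ->]; rewrite doubleK.
Qed.

Lemma double_dtype : Defs.double (dtype a b) = bsizes (ucomp a b) 2.
Proof.
rewrite /Defs.double /dtype -map_comp map_id_in // => k.
rewrite mem_sort => /mapP[C]; rewrite mem_filter => /andP[_].
by rewrite mem_enum => /imsetP[x _ e] -> /=; rewrite e card_ucomp doubleK mul2n.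
Qed.

(** A part [k] stands for a component with [2k] points, made of two [k]-cycles of [a * b]. *)
Lemma count_dtype k : 1 < k -> count_mem k (dtype a b) * k.*2 = cycle_points c k.
Proof.
move=> hk.
have -> : count_mem k (dtype a b) = count_mem k.*2 (bsizes (ucomp a b) 2).
  rewrite -double_dtype [in RHS]count_map; apply: eq_count => x /=.
  by rewrite -mul2n eqn_pmul2l.
rewrite count_bsizes; [|exact: ucomp_id|exact: ucompE].
rewrite -(ltn_double 1) in hk; rewrite hk; apply: eq_card => x.
by rewrite !inE card_ucomp -!mul2n eqn_pmul2l.
Qed.

Lemma dtype_eqP mu : isP2 mu ->
  (dtype a b = mu) <-> (forall k, 1 < k -> cycle_points c k = count_mem k mu * k.*2).
Proof.
move=> hmu; split=> [<- k hk|h]; first by rewrite count_dtype.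
apply: P2_eq => [|//|k hk]; first exact: dtype_P2.
have hk2 : 0 < k.*2 by rewrite double_gt0 ltnW.
by apply/eqP; rewrite -(eqn_pmul2r hk2) count_dtype // h.
Qed.

(** The nontrivial components consist of the points moved by [a * b], and [a * b] fixes [x] exactly
    when [a x = b x]. *)
Lemma sumn_dtype : (sumn (dtype a b)).*2 = #|[set x | a x != b x]|.
Proof.
have -> : (sumn (dtype a b)).*2 = sumn (bsizes (ucomp a b) 2).
  rewrite -double_dtype; elim: (dtype a b) => //= x s <-.
  by rewrite doubleD mul2n.
rewrite sumn_bsizes; [|exact: ucomp_id|exact: ucompE].
apply: eq_card => x; rewrite !inE card_ucomp (ltn_double 1) card_porbit_gt1.
by rewrite -(inj_eq (can_inj bK)) /c permM bK.
Qed.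

Lemma sort_ucomp :
  sort geq [seq #|(C : {set T})| | C <- enum [set ucomp a b x | x : T]]
   = Defs.double (pad (dtype a b) #|T|./2).
Proof.
rewrite (@blocks_pad _ _ ucomp_id ucompE 2) //; last first.
  by move=> x; rewrite card_ucomp (leq_double 1) card_porbit_gt0.
rewrite -double_dtype /pad /Defs.double map_cat map_nseq; congr (_ ++ nseq _ _).
have -> : sumn [seq 2 * x | x <- dtype a b] = (sumn (dtype a b)).*2.
  by elim: (dtype a b) => //= x s ->; rewrite doubleD mul2n.
by rewrite divn2 -!divn2; lia.
Qed.

End Dihedral.

(** * Pairs of involutions up to conjugation *)

Section ComponentIso.
Variable T : finType.

(** The exponent [i] matters only modulo the common cycle length, so sending [c ^+ i] at [x] to
    [c' ^+ i] at [x'] is well defined. *)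
Lemma porbit_iso (c c' : {perm T}) (x x' : T) :
  #|porbit c x| = #|porbit c' x'| ->
  exists e : T -> T, forall i, e ((c ^+ i)%g x) = (c' ^+ i)%g x'.
Proof.
move=> E; set k := #|porbit c x|.
have permmod (d : {perm T}) z i : (d ^+ i)%g z = (d ^+ (i %% #|porbit d z|))%g z.
  rewrite {1}(divn_eq i #|porbit d z|) expgD permM; congr (_ _).
  elim: (i %/ _) => [|j IH]; first by rewrite mul0n expg0 perm1.
  by rewrite mulSnr expgD permM IH permX iter_porbit.
exists (fun y => (c' ^+ (index y (traject c x k)))%g x') => i.
rewrite [in RHS]permmod (permmod c) -E; congr ((c' ^+ _)%g _).
have lt : i %% k < k by rewrite ltn_mod card_porbit_gt0.
by rewrite -/k (permX c) -(nth_traject c lt x) index_uniq ?size_traject ?uniq_traject_porbit.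
Qed.

Variables (a b a' b' : {perm T}).
Hypotheses (ha : fpf a) (hb : fpf b) (ha' : fpf a') (hb' : fpf b').
Let c := (a * b)%g.
Let c' := (a' * b')%g.

Lemma ucomp_closed (D : {set T}) x : (forall y, y \in D -> a y \in D) ->
  (forall y, y \in D -> b y \in D) -> x \in D -> ucomp a b x \subset D.
Proof.
move=> Da Db xD.
suff H y : y \in D -> porbit (a * b) y \subset D.
  by rewrite subUset !H // Da.
move=> yD; apply/subsetP=> z /porbitP[i ->].
by elim: i => [|i IH]; rewrite ?expg0 ?perm1 // expgSr !permM Db ?Da.
Qed.

Definition equivariant (D : {set T}) (h : T -> T) : Prop :=
  [/\ {in D, forall y, a y \in D}, {in D, forall y, b y \in D},
      {in D, forall y, h (a y) = a' (h y)} & {in D, forall y, h (b y) = b' (h y)}].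

(** The map [e1] between the cycles of [x] and [x'] is extended to the opposite cycle by
    [e (a y) = a' (e1 y)]. Compatibility with [b] follows from [b (a z) = c z] and compatibility of
    [e1] with [c]. *)
Lemma ucomp_iso x x' : #|porbit c x| = #|porbit c' x'| ->
  exists e : T -> T, [/\ {in ucomp a b x &, injective e}, equivariant (ucomp a b x) e
    & {in ucomp a b x, forall y, e y \in ucomp a' b' x'}].
Proof.
move=> E; have [e1 e1P] := porbit_iso E.
have e1K y : y \in porbit c x -> e1 y \in porbit c' x'.
  by case/porbitP=> i ->; rewrite e1P mem_porbit.
have e1c y : y \in porbit c x -> e1 (c y) = c' (e1 y).
  by case/porbitP=> i ->; rewrite -permM -expgSr !e1P expgSr permM.
have cc y : y \in porbit c x -> c y \in porbit c x.
  by case/porbitP=> i ->; rewrite -permM -expgSr mem_porbit.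
have e1inj : {in porbit c x &, injective e1}.
  have im : e1 @: porbit c x = porbit c' x'.
    apply/setP => z; apply/imsetP/idP => [[y /e1K h ->] //|/porbitP[i ->]].
    by exists ((c ^+ i)%g x); rewrite ?e1P ?mem_porbit.
  by apply/imset_injP; rewrite im E.
have anotin y : y \in porbit c x -> a y \notin porbit c x.
  by move=> /porbit_eq <-; apply: fpf_porbit_notin.
pose e y := if y \in porbit c x then e1 y else a' (e1 (a y)).
have eE y : y \in porbit c x -> e y = e1 y by rewrite /e => ->.
have eaE y : y \in porbit c x -> e (a y) = a' (e1 y).
  by move=> hy; rewrite /e (negbTE (anotin _ hy)) (fpfK ha).
have compP y : y \in ucomp a b x -> exists2 z, z \in porbit c x & y = z \/ y = a z.
  rewrite inE => /orP[] hy; first by exists y; [|left].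
  exists (a y); last by right; rewrite (fpfK ha).
  by rewrite -(fpf_porbit ha hb) (fpfK ha).
have inC z : z \in porbit c x -> z \in ucomp a b x by rewrite inE => ->.
have inaC z : z \in porbit c x -> a z \in ucomp a b x.
  by move=> h; rewrite inE fpf_porbit // h orbT.
have inC' z : z \in porbit c x -> e1 z \in ucomp a' b' x'.
  by move=> /e1K h; rewrite inE h.
have inaC' z : z \in porbit c x -> a' (e1 z) \in ucomp a' b' x'.
  by move=> /e1K h; rewrite inE fpf_porbit // h orbT.
have bE z : z \in porbit c x -> exists2 w, w \in porbit c x & z = b (a w).
  move=> hz; exists ((c^-1)%g z).
    by rewrite -(porbit_eq hz) -porbitV (mem_porbit _ 1).
  by rewrite -permM permKV.
exists e; split.
- move=> y1 y2 /compP[z1 h1 []-> ] /compP[z2 h2 []->];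
    rewrite ?(eaE z1 h1) ?(eE z1 h1) ?(eaE z2 h2) ?(eE z2 h2).
  + exact: e1inj.
  + move=> e12; have := fpf_porbit_notin ha' hb' (e1 z2).
    by rewrite -e12 -eq_porbit_mem (porbit_eq (e1K _ h1)) (porbit_eq (e1K _ h2)) eqxx.
  + move=> e12; have := fpf_porbit_notin ha' hb' (e1 z1).
    by rewrite e12 -eq_porbit_mem (porbit_eq (e1K _ h1)) (porbit_eq (e1K _ h2)) eqxx.
  + by move/perm_inj => h; congr (a _); apply: e1inj.
- split.
  + by move=> y /compP[z hz []->]; rewrite ?(fpfK ha); [apply: inaC|apply: inC].
  + move=> y /compP[z hz []->]; last by apply: inC; rewrite -permM; apply: cc.
    by have [w hw ->] := bE z hz; rewrite (fpfK hb); apply: inaC.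
  + by move=> y /compP[z hz []->]; rewrite ?(fpfK ha) ?eaE ?eE // (fpfK ha').
  + move=> y /compP[z hz []->].
      have [w hw ez] := bE z hz; rewrite {1}ez (fpfK hb) eaE // eE //.
      have -> : z = c w by rewrite permM.
      by rewrite e1c // permM (fpfK hb').
    have -> : b (a z) = c z by rewrite permM.
    by rewrite eE ?cc // e1c // eaE // permM.
- by move=> y /compP[z hz []->]; rewrite ?eaE ?eE //; [apply: inC'|apply: inaC'].
Qed.
End ComponentIso.

(** The image of [D] is stable under [a'] and [b'], so it contains the whole component of [h x]. *)
Lemma equivariant_mem_ucomp (T : finType) (a b a' b' : {perm T}) D h x :
  equivariant a b a' b' D h -> x \in D -> 
  forall z, z \in ucomp a' b' (h x) -> exists2 y, y \in D & z = h y.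
Proof.
case=> Da Db ea eb xD z zC.
suff : ucomp a' b' (h x) \subset h @: D by move/subsetP/(_ z zC)/imsetP.
apply: ucomp_closed; last exact: imset_f.
- by move=> _ /imsetP[y yD ->]; rewrite -ea // imset_f // Da.
- by move=> _ /imsetP[y yD ->]; rewrite -eb // imset_f // Db.
Qed.

Section PartialIso.
Variable T : finType.
Variables (a b a' b' : {perm T}).
Hypotheses (ha : fpf a) (hb : fpf b) (ha' : fpf a') (hb' : fpf b').
Let c := (a * b)%g.
Let c' := (a' * b')%g.
Hypothesis cp : forall k, cycle_points c k = cycle_points c' k.

Definition partial_iso (D : {set T}) (h : T -> T) : Prop :=
  [/\ {in D &, injective h}, equivariant a b a' b' D h
    & {in D, forall y, #|porbit c' (h y)| = #|porbit c y|}].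

Lemma partial_iso_extend D h : partial_iso D h -> D != setT ->
  exists D' h', partial_iso D' h' /\ #|~: D'| < #|~: D|.
Proof.
case=> hinj heq hord Dn.
have [x xD] : exists x, x \notin D.
  by apply/existsP; rewrite -negb_forall; apply: contra Dn => /forallP h'; apply/eqP/setP => y; rewrite inE h'.
pose K := [set y | #|porbit c y| == #|porbit c x|].
pose K' := [set y | #|porbit c' y| == #|porbit c x|].
(* [K] and [K'] have equal size, and [h] uses only [#|D :&: K| < #|K|] points of [K'], because [x]
   lies in [K] outside [D]. *)
have [x' x'K x'D] : exists2 x', x' \in K' & x' \notin h @: D.
  have : #|h @: (D :&: K)| < #|K'|.
    rewrite card_in_imset; last by move=> y z /setIP[hy _] /setIP[hz _]; apply: hinj.
    have -> : #|K'| = #|K| by have := cp #|porbit c x|.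
    apply: proper_card; rewrite properE subsetIr; apply/subsetPn; exists x.
      by rewrite inE.
    by rewrite !inE (negbTE xD).
  move=> lt.
  have /subsetPn[x' h1 h2] : ~~ (K' \subset h @: (D :&: K)).
    by apply/negP => /subset_leq_card; rewrite leqNgt lt.
  exists x' => //; apply: contra h2 => /imsetP[z zD e]; rewrite e imset_f // inE zD.
  by move: h1; rewrite e !inE hord.
have [e [einj [ea1 ea2 ea3 ea4] eC]] := @ucomp_iso T a b a' b' ha hb ha' hb' x x' (esym (eqP (etrans (esym (in_set _ _)) x'K))).
have [Da Db h1 h2] := heq.
have disj y : y \in ucomp a b x -> y \notin D.
  move=> hy; apply: contra xD => yD.
  have /subsetP := ucomp_closed Da Db yD; apply.
  by rewrite (ucompE ha hb hy) ucomp_id.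
pose h' y := if y \in D then h y else e y.
have hD y : y \in D -> h' y = h y by rewrite /h' => ->.
have hC y : y \in ucomp a b x -> h' y = e y by rewrite /h' => /disj/negbTE ->.
have disj' y z : y \in D -> z \in ucomp a b x -> h y <> e z.
  move=> yD zC eq; move: x'D; apply/negP; rewrite negbK.
  have x'C : x' \in ucomp a' b' (h y).
    by rewrite eq (ucompE ha' hb' (eC _ zC)) ucomp_id.
  by have [w wD ->] := equivariant_mem_ucomp heq yD x'C; apply: imset_f.
exists (D :|: ucomp a b x), h'; split; last first.
  apply: proper_card; rewrite properE setCS subsetUl; apply/subsetPn; exists x.
    by rewrite inE.
  by rewrite !inE porbit_id orbT.
split.
- move=> y z /setUP[] hy /setUP[] hz; rewrite ?(hD _ hy) ?(hD _ hz) ?(hC _ hy) ?(hC _ hz).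
  + exact: hinj.
  + by move/disj'=> /(_ hy hz).
  + by move/esym/disj'=> /(_ hz hy).
  + exact: einj.
- split=> y /setUP[] hy.
  + by rewrite inE Da.
  + by rewrite inE ea1 ?orbT.
  + by rewrite inE Db.
  + by rewrite inE ea2 ?orbT.
  + by rewrite !hD ?Da ?h1.
  + by rewrite !hC ?ea1 ?ea3.
  + by rewrite !hD ?Db ?h2.
  + by rewrite !hC ?ea2 ?ea4.
- move=> y /setUP[] hy; first by rewrite hD ?hord.
  apply/eqP; rewrite hC // -(inj_eq double_inj) -!card_ucomp //.
  rewrite (ucompE ha hb hy) (ucompE ha' hb' (eC _ hy)) !card_ucomp //.
  by move: x'K; rewrite inE => /eqP ->.
Qed.

Lemma pair_conj_cycle_points : exists h : {perm T}, (a ^ h = a')%g /\ (b ^ h = b')%g.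
Proof.
have H n : forall D h, partial_iso D h -> #|~: D| <= n -> exists h', partial_iso setT h'.
  elim: n => [|n IH] D h p; case: (D =P setT) => [<-|/eqP Dn]; try by exists h.
    by move=> le0; case/negP: Dn; rewrite -(setCK D) -setC0 (inj_eq (@setC_inj T)) -cards_eq0 -leqn0.
  move=> len; have [D' [h' [p' lt]]] := partial_iso_extend p Dn.
  by apply: (IH D' h' p'); rewrite -ltnS; apply: leq_trans len.
have [||h [hinj [_ _ h1 h2] _]] := H #|T| set0 id.
- by split; [|split|] => y; rewrite inE.
- exact: max_card.
have hi : injective h by move=> x y; apply: hinj; rewrite inE.
exists (perm hi); split; apply/permP => y; rewrite -(permKV (perm hi) y) permJ !permE.
  by rewrite h1 ?inE // -(permE hi) permKV.
by rewrite h2 ?inE // -(permE hi) permKV.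
Qed.

End PartialIso.

(** [dtype] determines the number of points on cycles of every length: directly for lengths at least
    2, by complement for length 1. *)
Lemma pair_conj (T : finType) (a b a' b' : {perm T}) :
  fpf a -> fpf b -> fpf a' -> fpf b' -> dtype a b = dtype a' b' ->
  exists h : {perm T}, (a ^ h = a')%g /\ (b ^ h = b')%g.
Proof.
move=> ha hb ha' hb' e; apply: pair_conj_cycle_points => // k.
case: (ltnP 1 k) => [k1|]; first by rewrite -!count_dtype // e.
have cp1 (x y : {perm T}) : fpf x -> fpf y ->
    cycle_points (x * y) 1 = #|T| - (sumn (dtype x y)).*2.
  move=> hx hy; rewrite sumn_dtype // /cycle_points cardsCs; congr (_ - _).
  apply: eq_card => z.
  rewrite !inE eqn_leq card_porbit_gt0 andbT -ltnNge card_porbit_gt1 permM.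
  by rewrite -(inj_eq (can_inj (fpfK hy))) (fpfK hy).
case: k => [|[|//]] _; last by rewrite !cp1 // e.
by rewrite /cycle_points !eq_card0 // => x; rewrite !inE (negbTE (card_porbit_neq0 _ _)).
Qed.

(** * Matchings as involutions *)

Section Mate.
Variable m : nat.
Implicit Types A B : matching m.

(** The default [x] is never reached when [A] is a perfect matching. *)
Definition mate_fun (A : {set {set 'I_m}}) (x : 'I_m) : 'I_m :=
  odflt x [pick y | (y != x) && ([set x; y] \in A)].

Lemma mate_funP (A : {set {set 'I_m}}) x : is_pm A ->
  [/\ mate_fun A x != x, [set x; mate_fun A x] \in A &
      forall e, e \in A -> x \in e -> e = [set x; mate_fun A x]].
Proof.
case/andP => /forall_inP h2 /forallP /(_ x) /cards1P[e0 h0].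
have e0P e : e \in A -> x \in e -> e = e0.
  by move=> h h'; apply/eqP; rewrite -in_set1 -h0 inE h.
have : e0 \in [set e0] by rewrite inE.
rewrite -h0 inE => /andP[e0A xe0].
have [y xy e0E] : exists2 y, y != x & e0 = [set x; y].
  have /cards2P[u [v [uv e]]] := h2 _ e0A.
  move: xe0; rewrite e !inE => /orP[]/eqP ->.
    by exists v => //; rewrite eq_sym.
  by exists u => //; rewrite setUC.
rewrite /mate_fun; case: pickP => [z /andP[z1 z2]|/(_ y)] /=; last first.
  by rewrite xy -e0E e0A.
split=> // e eA xe; rewrite (e0P _ eA xe); apply/esym/e0P => //.
by rewrite !inE eqxx.
Qed.

Lemma mate_funK (A : {set {set 'I_m}}) : is_pm A -> involutive (mate_fun A).
Proof.
move=> hA x; have [h1 h2 _] := mate_funP x hA.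
have [h4 h5 h6] := mate_funP (mate_fun A x) hA.
have /setP/(_ x) := h6 _ h2 (set22 _ _).
by rewrite !inE eqxx eq_sym (negbTE h1) /= => /esym/eqP.
Qed.

Definition mate A : {perm 'I_m} := perm (can_inj (mate_funK (valP A))).

Lemma mateK A : involutive (mate A).
Proof. by move=> x; rewrite !permE mate_funK // (valP A). Qed.

Lemma mate_fpf A : fpf (mate A).
Proof.
apply/forallP => x; rewrite mateK eqxx permE /=.
by have [] := mate_funP x (valP A).
Qed.

Lemma mem_matching A (e : {set 'I_m}) x : x \in e ->
  (e \in val A) = (e == [set x; mate A x]).
Proof.
move=> xe; rewrite permE; have [_ h2 h3] := mate_funP x (valP A).
by apply/idP/eqP => [/h3 -> //|-> //].
Qed.

Lemma matching_edge A (e : {set 'I_m}) : e \in val A -> exists2 x, x \in e & e = [set x; mate A x].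
Proof.
move=> eA; have /andP[/forall_inP/(_ e eA) /cards2P[x [y [_ eE]]] _] := valP A.
have xe : x \in e by rewrite eE set21.
by exists x => //; apply/eqP; rewrite -mem_matching.
Qed.

Lemma mate_inj : injective mate.
Proof.
suff H A B : mate A = mate B -> val A \subset val B.
  by move=> A B e; apply/val_inj/eqP; rewrite eqEsubset !H.
move=> e; apply/subsetP => E /matching_edge[x xE ->].
by rewrite (@mem_matching B _ x) ?e // set21.
Qed.

Lemma mate_surj (a : {perm 'I_m}) : fpf a -> exists A, mate A = a.
Proof.
move=> ha; pose S := [set [set x; a x] | x : 'I_m].
have SP x (e : {set 'I_m}) : x \in e -> (e \in S) = (e == [set x; a x]).
  move=> xe; apply/imsetP/eqP => [[y _ E]|->]; last by exists x.
  move: xe; rewrite E !inE => /orP[]/eqP -> //.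
  by rewrite (fpfK ha) setUC.
have pS : is_pm S.
  apply/andP; split.
    by apply/forall_inP => e /imsetP[x _ ->]; rewrite cards2 [x == _]eq_sym fpf_neq.
  apply/forallP => x; apply/cards1P; exists [set x; a x].
  apply/setP => e; rewrite !inE; case: (boolP (x \in e)) => [/SP ->|].
    by rewrite andbT.
  by rewrite andbF; case: eqP => // ->; rewrite set21.
exists (exist _ S pS); apply/permP => x; rewrite permE /=.
have [h1 h2 _] := mate_funP x pS.
rewrite (SP x) ?set21 // in h2; move/eqP/setP: h2 => /(_ (mate_fun S x)).
by rewrite !inE eqxx (negbTE h1) => /esym/eqP.
Qed.

(** The image is the matching of the conjugate involution. Consequently the default value in the
    definition of [mact] is never taken. *)
Lemma mact_raw_pm (s : {perm 'I_m}) A : is_pm (mact_raw s (val A)).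
Proof.
have [B eB] := mate_surj (fpfJ s (mate_fpf A)).
suff -> : mact_raw s (val A) = val B by exact: valP.
have im x : s @: [set x; mate A x] = [set s x; mate B (s x)].
  by rewrite imsetU !imset_set1 eB permJ.
apply/setP => e; apply/imsetP/idP => [[_ /matching_edge[x _ ->] ->]|/matching_edge[x _ ->]].
  by rewrite im (@mem_matching _ _ (s x)) ?set21.
exists [set (s^-1)%g x; mate A ((s^-1)%g x)]; last by rewrite im permKV.
by rewrite (@mem_matching _ _ ((s^-1)%g x)) ?set21.
Qed.

Lemma val_mact (s : {perm 'I_m}) A : val (Defs.mact s A) = mact_raw s (val A).
Proof. by rewrite /Defs.mact insubdK //; apply: mact_raw_pm. Qed.

Lemma mate_mact (s : {perm 'I_m}) A : mate (Defs.mact s A) = (mate A ^ s)%g.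
Proof.
apply/permP => x; rewrite -(permKV s x) permJ; set y := (s^-1)%g x.
have : s @: [set y; mate A y] \in val (Defs.mact s A).
  by rewrite val_mact imset_f // (@mem_matching _ _ y) ?set21.
rewrite (@mem_matching _ _ (s y)); last by rewrite imset_f ?set21.
rewrite imsetU !imset_set1 => /eqP/setP/(_ (s (mate A y))).
by rewrite !inE eqxx orbT (inj_eq perm_inj) (negbTE (fpf_neq _ (mate_fpf A))) => /esym/eqP.
Qed.

Lemma mact_eq (s : {perm 'I_m}) A B : (Defs.mact s A == B) = (mate A ^ s == mate B)%g.
Proof. by rewrite -(inj_eq mate_inj) mate_mact. Qed.

Lemma union_relE A B x y :
  union_rel (val A) (val B) x y = [|| y == x, y == mate A x | y == mate B x].
Proof.
apply/existsP/or3P => [[e /andP[/andP[/orP[] eM xe] ye]]|].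
- move: eM ye; rewrite (mem_matching _ xe) => /eqP ->.
  by rewrite !inE => /orP[]->; [apply: Or31|apply: Or32].
- move: eM ye; rewrite (mem_matching _ xe) => /eqP ->.
  by rewrite !inE => /orP[]->; [apply: Or31|apply: Or33].
have hA : [set x; mate A x] \in val A by rewrite (@mem_matching _ _ x) ?set21.
have hB : [set x; mate B x] \in val B by rewrite (@mem_matching _ _ x) ?set21.
case=> /eqP ->.
- by exists [set x; mate A x]; rewrite hA set21.
- by exists [set x; mate A x]; rewrite hA set21 set22.
- by exists [set x; mate B x]; rewrite hB orbT set21 set22.
Qed.

(** Each edge of a path joins points of one [ucomp]; conversely one application of [a * b] follows
    an edge of [A] and then an edge of [B]. *)
Lemma connect_union A B x y :
  connect (union_rel (val A) (val B)) x y = (y \in ucomp (mate A) (mate B) x).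
Proof.
have [hA hB] := (mate_fpf A, mate_fpf B).
apply/idP/idP => [/connectP[p]|].
  elim: p x => [|z p IH] x /=; first by move=> _ ->; apply: ucomp_id.
  rewrite union_relE => /andP[h1 h2] e.
  have <- : ucomp (mate A) (mate B) z = ucomp (mate A) (mate B) x.
    by case/or3P: h1 => /eqP -> //; [apply: ucompa|apply: ucompb].
  exact: IH.
have step z : connect (union_rel (val A) (val B)) x z ->
    forall w, w \in porbit (mate A * mate B) z -> connect (union_rel (val A) (val B)) x w.
  move=> xz w /porbitP[i ->]; elim: i => [|i IH]; first by rewrite expg0 perm1.
  rewrite expgSr permM; apply: connect_trans IH _.
  move: (_ z) => v; rewrite permM.
  apply: (@connect_trans _ _ (mate A v)); apply: connect1; rewrite union_relE eqxx !orbT //.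
rewrite inE => /orP[]; first exact: step.
by apply: step; apply: connect1; rewrite union_relE eqxx orbT.
Qed.

Lemma distE A B : dist A B = Defs.double (pad (dtype (mate A) (mate B)) m./2).
Proof.
have := sort_ucomp (mate_fpf A) (mate_fpf B); rewrite card_ord => <-.
have e : components (val A) (val B) = [set ucomp (mate A) (mate B) x | x : 'I_m].
  by apply: eq_imset => x; apply/setP => y; rewrite inE connect_union.
by rewrite /dist /dist_raw e.
Qed.

Lemma dist_eq A B tau : isP2 tau ->
  (dist A B == Defs.double (pad tau m./2)) = (dtype (mate A) (mate B) == tau).
Proof. by move=> h; rewrite distE doubleP2E // dtype_P2 // mate_fpf. Qed.

End Mate.

Lemma I_raw_pm s : is_pm (I_raw s).
Proof.
have hl (i : 'I_s) : i < s.*2 by rewrite -addnn ltn_addr.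
have hr (i : 'I_s) : s + i < s.*2 by rewrite -addnn ltn_add2l.
pose E (i : 'I_s) := [set Ordinal (hl i); Ordinal (hr i)].
have IP e : reflect (exists i, e = E i) (e \in I_raw s).
  have EE (i : 'I_s) : [set x : 'I_(s.*2) | (val x == val i) || (val x == s + val i)%N] = E i.
    by apply/setP => x; rewrite !inE -!val_eqE.
  rewrite inE; apply: (iffP existsP) => [[i /eqP ->]|[i ->]]; exists i; by rewrite EE.
apply/andP; split.
  apply/forall_inP => e /IP[i ->]; rewrite cards2 -val_eqE /=.
  by have := ltn_ord i; case: eqP => //; lia.
apply/forallP => x; apply/cards1P.
have xs := ltn_ord x.
(* The index of the edge of [I_s] through [x]. *)
pose k := if x < s then x : nat else x - s.
have kE : (x < s) && (x == k :> nat) || (s <= x) && (x == s + k :> nat).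
  by rewrite /k; case: ltnP => h; rewrite ?eqxx //= subnKC ?eqxx.
have ks : k < s by move: kE xs; clearbody k; lia.
exists (E (Ordinal ks)); apply/setP => e; rewrite [LHS]inE in_set1.
apply/andP/eqP => [[]|->].
  move=> /IP[i ->]; rewrite !inE -!val_eqE /= => h; congr E; apply: val_inj => /=.
  by have := ltn_ord i; move: h kE; clearbody k; lia.
split; first by apply/IP; exists (Ordinal ks).
by rewrite !inE -!val_eqE /=; move: kE; clearbody k; lia.
Qed.

(** * Counting conjugating permutations of a given type *)

Lemma conjg_eqP (T : finType) (a b g : {perm T}) :
  reflect (forall x, g (a x) = b (g x)) (a ^ g == b)%g.
Proof.
apply: (iffP eqP) => [<- x|h]; first by rewrite permJ.
by apply/permP => x; rewrite -(permKV g x) permJ h.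
Qed.

(** * Transport of permutations along an injection *)

Section Embed.
Variables (T T' : finType) (phi : T' -> T).
Hypothesis phi_inj : injective phi.

Lemma porbit_embed (g : {perm T}) (g' : {perm T'}) x :
  (forall z, g (phi z) = phi (g' z)) -> porbit g (phi x) = phi @: porbit g' x.
Proof.
move=> h; have it i : (g ^+ i)%g (phi x) = phi ((g' ^+ i)%g x).
  by elim: i => [|i IH]; rewrite ?expg0 ?perm1 // !expgSr !permM IH h.
apply/setP => y; apply/porbitP/imsetP => [[i ->]|[_ /porbitP[i ->] ->]].
  by exists ((g' ^+ i)%g x); rewrite ?mem_porbit.
by exists i; rewrite it.
Qed.

(** Points outside the image are fixed by [g], so they only affect the count for [k = 1]. *)
Lemma cycle_points_embed (g : {perm T}) (g' : {perm T'}) k :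
  (forall x, g (phi x) = phi (g' x)) -> (forall y, y \notin codom phi -> g y = y) ->
  1 < k -> cycle_points g k = cycle_points g' k.
Proof.
move=> h1 h2 hk; have po x := porbit_embed x h1.
rewrite /cycle_points -(card_imset _ phi_inj); apply: eq_card => y; rewrite inE.
apply/idP/imsetP => [/eqP hy|[x]]; last first.
  by rewrite inE => h ->; rewrite po card_imset.
have : g y != y by rewrite -card_porbit_gt1 hy.
case: (boolP (y \in codom phi)) => [/codomP[x ex] _|/h2 ->]; last by rewrite eqxx.
by exists x => //; rewrite inE -(card_imset _ phi_inj) -po -ex hy.
Qed.

Lemma ntype_embed (g : {perm T}) (g' : {perm T'}) :
  (forall x, g (phi x) = phi (g' x)) -> (forall y, y \notin codom phi -> g y = y) ->
  ntype g = ntype g'.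
Proof.
move=> h1 h2; apply/ntype_eqP => [|k hk]; first exact: ntype_P2.
by rewrite (cycle_points_embed h1 h2 hk) count_ntype.
Qed.

Lemma perm_extend (g' : {perm T'}) : exists g : {perm T},
  (forall x, g (phi x) = phi (g' x)) /\ (forall y, y \notin codom phi -> g y = y).
Proof.
pose f (h : {perm T'}) y := if [pick x | phi x == y] is Some x then phi (h x) else y.
have f1 h x : f h (phi x) = phi (h x).
  rewrite /f; case: pickP => [z /eqP /phi_inj -> //|/(_ x)].
  by rewrite eqxx.
have f2 h y : y \notin codom phi -> f h y = y.
  by rewrite /f; case: pickP => // z /eqP <-; rewrite codom_f.
have fK : cancel (f g') (f g'^-1%g).
  move=> y; case: (boolP (y \in codom phi)) => [/codomP[x ->]|h]; last by rewrite !f2.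
  by rewrite !f1 permK.
by exists (perm (can_inj fK)); split=> [x|y hy]; rewrite permE ?f1 ?f2.
Qed.

Lemma perm_pullback (p : {perm T}) : (forall x, p (phi x) \in codom phi) ->
  exists p' : {perm T'}, forall x, p (phi x) = phi (p' x).
Proof.
move=> h; have /fin_all_exists[f fP] x : exists z, p (phi x) = phi z.
  by have /codomP := h x.
have fi : injective f.
  by move=> x y e; apply/phi_inj/(@perm_inj _ p); rewrite !fP e.
by exists (perm fi) => x; rewrite permE.
Qed.

End Embed.

(** For the involutions [a], [b] of [A], [B], this is the coefficient of [B] in [f(mu,2n)] applied
    to [A]. *)
Definition pcount (T : finType) (a b : {perm T}) (mu : seq nat) : nat :=
  #|[set g : {perm T} | (ntype g == mu) && (a ^ g == b)%g]|.

Lemma pcountJ (T : finType) (a b h : {perm T}) mu :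
  pcount (a ^ h) (b ^ h) mu = pcount a b mu.
Proof.
rewrite /pcount -[RHS](card_imset _ (conjg_inj h)); apply: eq_card => g.
have nt (u : {perm T}) : ntype (u ^ h)%g = ntype u.
  apply: (ntype_embed (@perm_inj _ h)) => [x|y]; first by rewrite permJ.
  by rewrite -(permKV h y) codom_f.
rewrite -[g](conjgKV h) (mem_imset _ _ (conjg_inj h)) !inE nt -conjJg.
by rewrite (inj_eq (conjg_inj h)).
Qed.

Lemma dtype_diag (T : finType) (a : {perm T}) : fpf a -> dtype a a = [::].
Proof.
move=> ha; have := sumn_dtype ha ha; have := dtype_P2 ha ha.
rewrite (@eq_card0 _ [set x | a x != a x]); last by move=> x; rewrite inE eqxx.
by case: (dtype a a) => // x s /andP[_ /= /andP[h _]]; lia.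
Qed.

(** Whatever matching is picked in [mcount], its pair with [I_s] is conjugate to [(a, b)], and
    conjugation preserves [pcount]. *)
Lemma mcountE s (a b : {perm 'I_(s.*2)}) mu : isP2 mu -> fpf a -> fpf b ->
  mcount s (pad mu s.*2) (pad (dtype a b) s) = pcount a b mu.
Proof.
move=> hmu ha hb; pose I : matching s.*2 := Sub (I_raw s) (I_raw_pm s).
have hI := mate_fpf I.
have distI A : (dist_raw (I_raw s) (val A) == Defs.double (pad (dtype a b) s))
    = (dtype (mate I) (mate A) == dtype a b).
  by rewrite -dist_eq ?dtype_P2 // doubleK.
rewrite /mcount; case: pickP => [A|none]; last first.
  (* The empty case of [pick] is impossible: a permutation conjugating [a] to the involution of
     [I_s] carries [b] to a matching at the required distance. *)
  have [|h [h1 h2]] := pair_conj ha ha hI hI; first by rewrite !dtype_diag.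
  have [A hA] := mate_surj (fpfJ h hb).
  have := none A; rewrite distI hA -h1.
  suff -> : dtype (a ^ h) (b ^ h) = dtype a b by rewrite eqxx.
  apply/dtype_eqP; rewrite ?fpfJ ?dtype_P2 // => k k1.
  rewrite -conjMg count_dtype //; apply: (cycle_points_embed (@perm_inj _ h)) => // [x|y].
    by rewrite permJ.
  by rewrite -(permKV h y) codom_f.
rewrite distI => /eqP e; have [h [h1 h2]] := pair_conj ha hb hI (mate_fpf A) (esym e).
rewrite -(pcountJ a b h) h1 h2; apply: eq_card => g; rewrite !inE ctype_eq //.
by rewrite -mact_eq -(inj_eq val_inj (Defs.mact g I)) val_mact.
Qed.

Section Restrict.
Variables (T : finType) (a b : {perm T}) (mu : seq nat) (V : {set T}) (s : nat).
Hypotheses (ha : fpf a) (hb : fpf b) (hmu : isP2 mu).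
Hypotheses (Va : forall x, x \in V -> a x \in V) (Vab : forall x, x \notin V -> a x = b x).
Hypothesis Vs : #|V| = s.*2.

(** An enumeration of [V] identifies the permutations supported on [V] with those of [2s] points. As
    [a] and [b] agree off [V], restricting the pair to [V] does not change [dtype]. *)
Lemma pcount_restrict :
  #|[set g : {perm T} | [&& perm_on V g, ntype g == mu & (a ^ g == b)%g]]|
  = mcount s (pad mu s.*2) (pad (dtype a b) s).
Proof.
have aK := fpfK ha; have bK := fpfK hb.
have Vb x : x \in V -> b x \in V.
  move=> xV; apply: contraT => h; have := Vab h; rewrite bK => e.
  by move: h; rewrite -[b x]aK e Va.
have Va' x : x \notin V -> a x \notin V by apply: contra => /Va; rewrite aK.
pose phi (i : 'I_(s.*2)) : T := enum_val (cast_ord (esym Vs) i).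
have phi_inj : injective phi by move=> i j /enum_val_inj /cast_ord_inj.
have phiV i : phi i \in V by exact: enum_valP.
have codomV x : (x \in codom phi) = (x \in V).
  apply/codomP/idP => [[i ->] //|xV].
  exists (cast_ord Vs (enum_rank_in xV x)).
  by rewrite /phi cast_ordK enum_rankK_in.
have [a' a'P] : exists a' : {perm 'I_(s.*2)}, forall x, a (phi x) = phi (a' x).
  by apply: (perm_pullback phi_inj) => x; rewrite codomV Va.
have [b' b'P] : exists b' : {perm 'I_(s.*2)}, forall x, b (phi x) = phi (b' x).
  by apply: (perm_pullback phi_inj) => x; rewrite codomV Vb.
have ha' : fpf a'.
  apply/forallP => x; rewrite -!(inj_eq phi_inj) -!a'P aK eqxx; exact: fpf_neq.
have hb' : fpf b'.
  apply/forallP => x; rewrite -!(inj_eq phi_inj) -!b'P bK eqxx; exact: fpf_neq.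
have -> : dtype a b = dtype a' b'.
  apply/dtype_eqP; rewrite ?dtype_P2 // => k k1; rewrite count_dtype //.
  apply: (cycle_points_embed phi_inj) => // [x|y]; first by rewrite !permM a'P b'P.
  by rewrite codomV permM => /Va' /Vab <-; rewrite aK.
rewrite mcountE //.
have [L LP] := fin_all_exists (perm_extend phi_inj).
have Linj : injective L.
  move=> g h e; apply/permP => x; apply: phi_inj.
  by have [<- _] := LP g; have [<- _] := LP h; rewrite e.
rewrite /pcount -[RHS](card_imset _ Linj); apply: eq_card => g.
have Lconj g' : (a ^ L g' == b)%g = (a' ^ g' == b')%g.
  have [l1 l2] := LP g'.
  apply/conjg_eqP/conjg_eqP => h x.
    by apply: phi_inj; rewrite -l1 -a'P h l1 b'P.
  case: (boolP (x \in V)); last first.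
    by move=> xV; rewrite !l2 ?codomV ?Va' // Vab.
  by rewrite -codomV => /codomP[y ->]; rewrite a'P !l1 h b'P.
apply/idP/imsetP => [|[g']].
  rewrite inE => /and3P[gV /eqP gn gc].
  have [g' g'P] : exists g' : {perm 'I_(s.*2)}, forall x, g (phi x) = phi (g' x).
    by apply: (perm_pullback phi_inj) => x; rewrite codomV (perm_closed _ gV).
  have [l1 l2] := LP g'.
  have eg : g = L g'.
    apply/permP => x; case: (boolP (x \in codom phi)) => [/codomP[y ->]|h].
      by rewrite g'P l1.
    by rewrite l2 // (out_perm gV) // -codomV.
  exists g' => //; rewrite inE -Lconj -eg gc andbT -gn; apply/eqP/esym.
  by apply: (ntype_embed phi_inj) => // y; rewrite codomV; apply: out_perm.
rewrite !inE -Lconj => /andP[/eqP gn gc] ->; have [l1 l2] := LP g'.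
rewrite gc andbT -gn (ntype_embed phi_inj l1 l2) eqxx andbT.
apply/subsetP => x; rewrite inE; apply: contraR; rewrite -codomV => h.
by rewrite l2.
Qed.

End Restrict.

(** * Permutations moving a given set of edges *)

Lemma card_between (T : finType) (J R : {set T}) s : J \subset R -> #|J| <= s ->
  #|[set U : {set T} | [&& J \subset U, U \subset R & #|U| == s]]|
  = 'C(#|R| - #|J|, s - #|J|).
Proof.
move=> JR Js; rewrite -(cardsDS JR) -cards_draws.
have inj : {in [set W : {set T} | W \subset R :\: J & #|W| == s - #|J|] &,
             injective (fun W => J :|: W)}.
  have K (W : {set T}) : W \subset R :\: J -> (J :|: W) :\: J = W.
    rewrite subsetD => /andP[_ d].
    by rewrite setDUl setDv set0U; apply/setDidPl.
  move=> W W'; rewrite !inE => /andP[h _] /andP[h' _] e.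
  by rewrite -(K W h) e K.
rewrite -(card_in_imset inj); apply: eq_card => U; rewrite inE.
apply/and3P/imsetP => [[JU UR /eqP cU]|[W]].
  exists (U :\: J); last by rewrite setDE setUIr setUCr setIT; apply/esym/setUidPr.
  by rewrite inE setSD //= cardsDS // cU.
rewrite inE subsetD => /andP[/andP[WR d] /eqP cW] ->.
rewrite subsetUl subUset JR WR; split=> //.
rewrite cardsU cW (_ : J :&: W = set0) ?cards0 ?subn0 ?subnKC //.
by apply/eqP; rewrite setIC setI_eq0.
Qed.

(** The endpoint of smaller rank is chosen in each edge. Sets of edges of [A] are thereby
    represented by subsets of [R]. *)
Lemma half_system (T : finType) (a : {perm T}) : fpf a ->
  exists R : {set T}, forall x, (a x \in R) = (x \notin R).
Proof.
move=> ha; exists [set x | enum_rank x < enum_rank (a x)] => x.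
rewrite !inE (fpfK ha) -leqNgt [RHS]leq_eqVlt; case: eqP => // /ord_inj/enum_rank_inj e.
by have := fpf_neq x ha; rewrite e eqxx.
Qed.

Section HalfSystem.
Variables (T : finType) (a b : {perm T}) (R : {set T}).
Hypotheses (ha : fpf a) (hb : fpf b) (aR : forall x, (a x \in R) = (x \notin R)).
Let aK := fpfK ha.
Let bK := fpfK hb.

(** The vertex set of the edges represented by [U]. *)
Definition doubled (U : {set T}) : {set T} := U :|: a @: U.

Lemma mem_doubled U x : (x \in doubled U) = (x \in U) || (a x \in U).
Proof. by rewrite inE -{2}[x]aK (mem_imset _ _ (can_inj aK)). Qed.

Lemma card_doubled (U : {set T}) : U \subset R -> #|doubled U| = #|U|.*2.
Proof.
move=> UR; rewrite cardsU card_imset; last exact: can_inj aK.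
rewrite -addnn -[RHS]subn0; congr (_ - _); apply/eqP; rewrite cards_eq0 -subset0.
apply/subsetP => x; rewrite inE => /andP[/(subsetP UR) h /imsetP[y /(subsetP UR) h2 e]].
by move: h; rewrite e aR h2.
Qed.

Lemma card_half_system : #|T| = #|R|.*2.
Proof.
rewrite -card_doubled //; apply: eq_card => x.
by rewrite mem_doubled aR; case: (x \in R).
Qed.

(** It represents the edges of [A] that are not in [B]; [touched g] below represents the edges of
    [A] with an endpoint moved by [g]. *)
Definition discrepancy : {set T} := [set x in R | a x != b x].

Definition touched (g : {perm T}) : {set T} :=
  [set x in R | (g x != x) || (g (a x) != a x)].

Lemma discrepancy_sub : discrepancy \subset R.
Proof. by apply/subsetP => x; rewrite inE => /andP[]. Qed.

Lemma touched_sub g : touched g \subset R.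
Proof. by apply/subsetP => x; rewrite inE => /andP[]. Qed.

Lemma doubled_discrepancy : doubled discrepancy = [set x | a x != b x].
Proof.
apply/setP => x; rewrite mem_doubled !inE aR aK.
have -> : (x == b (a x)) = (a x == b x).
  by rewrite -(inj_eq (can_inj bK)) bK eq_sym.
by case: (x \in R); rewrite ?orbF.
Qed.

Lemma card_discrepancy : #|discrepancy| = sumn (dtype a b).
Proof.
apply: double_inj; rewrite sumn_dtype // -doubled_discrepancy card_doubled //.
exact: discrepancy_sub.
Qed.

Lemma touched_perm_on g (U : {set T}) : U \subset R -> perm_on (doubled U) g = (touched g \subset U).
Proof.
move=> UR; apply/subsetP/subsetP => h x.
  rewrite inE => /andP[xR /orP[] hx]; have := h _ hx; rewrite mem_doubled ?aK.
    by case/orP=> // /(subsetP UR); rewrite aR xR.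
  by case/orP=> // /(subsetP UR); rewrite aR xR.
rewrite inE mem_doubled => hx; case: (boolP (x \in R)) => xR.
  by rewrite h // inE xR hx.
by rewrite (h (a x)) ?orbT // inE aR xR aK hx orbT.
Qed.

(** An edge of [A] with both endpoints fixed by [g] is its own image, hence an edge of [B]. *)
Lemma discrepancy_touched g : (a ^ g = b)%g -> discrepancy \subset touched g.
Proof.
move=> e; apply/subsetP => x; rewrite !inE => /andP[-> h] /=.
apply: contraR h; rewrite negb_or !negbK => /andP[/eqP h1 /eqP h2].
by rewrite -[in b x]h1 -e permJ h2.
Qed.

(** Pairs [(U, g)] are counted twice, where [U] has [s] edges, contains the discrepancy, and
    includes all edges touched by [g]. For fixed [U] the count of [g] is [mcount]; for fixed [g] the
    count of [U] is a binomial coefficient. *)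
Lemma touched_count mu s : isP2 mu -> sumn (dtype a b) <= s ->
  'C(#|R| - sumn (dtype a b), s - sumn (dtype a b))
     * mcount s (pad mu s.*2) (pad (dtype a b) s)
  = \sum_(g : {perm T} | (ntype g == mu) && (a ^ g == b)%g)
       (#|touched g| <= s) * 'C(#|R| - #|touched g|, s - #|touched g|).
Proof.
move=> hmu js; have Js : #|discrepancy| <= s by rewrite card_discrepancy.
rewrite -card_discrepancy -(card_between discrepancy_sub) // -sum_nat_const.
rewrite (eq_bigr (fun U : {set T} => \sum_(g : {perm T} | (ntype g == mu) && (a ^ g == b)%g)
    (touched g \subset U : nat))); last first.
  move=> U; rewrite inE => /and3P[JU UR /eqP cU].
  rewrite -(@pcount_restrict T a b mu (doubled U) s) //.
  - rewrite -sum1_card [RHS]big_mkcond [LHS]big_mkcond; apply: eq_bigr => g _.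
    rewrite inE touched_perm_on //.
    by case: (touched g \subset U) => //=; case: ifP.
  - by move=> x; rewrite !mem_doubled aK orbC.
  - move=> x; apply: contraNeq => h.
    have : x \in doubled discrepancy by rewrite doubled_discrepancy inE.
    by rewrite !mem_doubled => /orP[] /(subsetP JU) ->; rewrite ?orbT.
  - by rewrite card_doubled // cU.
rewrite exchange_big /=; apply: eq_bigr => g /andP[_ /eqP /discrepancy_touched Jt].
case: leqP => [le|gt].
  rewrite mul1n -(card_between (touched_sub g)) // -sum1_card.
  rewrite [RHS]big_mkcond [LHS]big_mkcond; apply: eq_bigr => U _; rewrite !inE.
  case: (boolP (touched g \subset U)) => h /=; last by case: ifP.
  by rewrite (subset_trans Jt h).
(* No [U] exists here, while truncated subtraction would make the binomial equal to 1; hence the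
   factor [(#|touched g| <= s)]. *)
rewrite mul0n big1 // => U; rewrite inE => /and3P[_ _ /eqP cU].
by case: (boolP (_ \subset _)) => // /subset_leq_card; rewrite cU leqNgt gt.
Qed.

(** [f] selects a moved endpoint of each touched edge; distinct edges are disjoint. *)
Lemma touched_rep (g : {perm T}) (f := fun x => if g x != x then x else a x) :
  f @: touched g \subset [set x | g x != x] /\ {in touched g &, injective f}.
Proof.
split.
  apply/subsetP => _ /imsetP[x xt ->]; rewrite inE /f.
  by move: xt; rewrite inE; case: ifP => //= _ /andP[].
move=> x y; rewrite !inE /f => /andP[xR _] /andP[yR _].
case: ifP => _; case: ifP => _ // e; last exact: perm_inj e.
  by move: xR; rewrite e aR yR.
by move: yR; rewrite -e aR xR.
Qed.

Lemma card_touched_le (g : {perm T}) : #|touched g| <= #|[set x | g x != x]|.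
Proof.
by have [sub inj] := touched_rep g; rewrite -(card_in_imset inj) subset_leq_card.
Qed.

Lemma card_touched_ge (g : {perm T}) : #|[set x | g x != x]| <= #|touched g|.*2.
Proof.
have h : perm_on (doubled (touched g)) g by rewrite touched_perm_on // touched_sub.
rewrite -(card_doubled (touched_sub g)); apply/subset_leq_card/subsetP => x.
by rewrite inE => gx; apply: (subsetP h).
Qed.

(** In case of equality the injection of [touched_rep] is onto the support, so no edge has two moved
    endpoints. *)
Lemma touched_full (g : {perm T}) : #|touched g| = #|[set x | g x != x]| ->
  forall x, g x != x -> g (a x) = a x.
Proof.
move=> e; have [sub finj] := touched_rep g; set f := fun x => _ in sub finj.
have fE : f @: touched g = [set x | g x != x].
  by apply/eqP; rewrite eqEcard sub card_in_imset // e leqnn.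
move=> x gx; apply/eqP; apply: contraT => gax.
wlog xR : x gx gax / x \in R.
  case: (boolP (x \in R)) => [xR|xR] wl; first exact: (wl x).
  by apply: (wl (a x)); rewrite ?aK ?aR.
have : a x \in f @: touched g by rewrite fE inE.
case/imsetP => y; rewrite inE /f => /andP[yR _]; case: ifP => [_ ey|gy /perm_inj ey].
  by move: yR; rewrite -ey aR xR.
by move: gy; rewrite -ey gx.
Qed.

(** With equality, [a y] would be fixed for every moved [y], giving [b (a y) = g y], which differs
    from [y]. Then every touched edge would lie outside [B], and the discrepancy would be too
    large. *)
Lemma touched_lt (g : {perm T}) : (a ^ g = b)%g -> #|discrepancy| < #|[set x | g x != x]| ->
  #|touched g| < #|[set x | g x != x]|.
Proof.
move=> e lt; rewrite ltn_neqAle card_touched_le andbT; apply/eqP => eq.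
have tf := touched_full eq.
suff : touched g \subset discrepancy by move/subset_leq_card; rewrite eq leqNgt lt.
apply/subsetP => x; rewrite !inE => /andP[-> h] /=.
have H y : g y != y -> a y != b y.
  move=> gy; apply/eqP => eab.
  have : b (a y) = g y by rewrite -e -(tf y gy) permJ aK.
  by rewrite eab bK => e'; rewrite -e' eqxx in gy.
case/orP: h => h; first exact: H.
have := H _ h; rewrite aK; apply: contra => /eqP ->.
by rewrite bK.
Qed.

End HalfSystem.

(** * The case |tau| = |mu| *)

Section HalfSupport.
Variables (T : finType) (a b : {perm T}).
Hypotheses (ha : fpf a) (hb : fpf b).
Let c := (a * b)%g.
Let aK := fpfK ha.
Let bK := fpfK hb.

(** [S] consists of exactly one endpoint of each edge of [A] not in [B]. *)
Definition splits (S : {set T}) : Prop :=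
  (forall x, x \in S -> c x != x) /\ (forall x, c x != x -> (a x \in S) = (x \notin S)).

Definition agrees (g : {perm T}) (S : {set T}) : Prop :=
  (forall x, x \in S -> g x = c x) /\ (forall x, x \notin S -> g x = x).

Lemma agrees_supp g S : splits S -> agrees g S -> S = [set x | g x != x].
Proof.
case=> s1 _ [g1 g2]; apply/setP => x; rewrite inE.
by case: (boolP (x \in S)) => h; [rewrite g1 // s1|rewrite g2 // eqxx].
Qed.

Lemma agrees_porbit g S x : splits S -> agrees g S -> x \in S ->
  porbit c x = porbit g x /\ porbit c x \subset S.
Proof.
move=> sp ag xS; have [g1 g2] := ag; have SE := agrees_supp sp ag.
have SC y : y \in S -> g y \in S by rewrite SE !inE (inj_eq perm_inj).
have H i : (c ^+ i)%g x = (g ^+ i)%g x /\ (g ^+ i)%g x \in S.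
  elim: i => [|i [IH1 IH2]]; first by rewrite !expg0 perm1.
  by rewrite !expgSr !permM IH1 -(permM a b) -/c g1 // -g1 // SC.
split.
  apply/setP => y; apply/porbitP/porbitP => -[i ->]; exists i; by have [] := H i.
by apply/subsetP => y /porbitP[i ->]; have [-> ] := H i.
Qed.

(** The nontrivial cycles of [c] inside [S] are those of [g], and [a] maps them to the remaining
    ones; so [c] has twice as many points on [k]-cycles as [g]. *)
Lemma agrees_dtype g S : splits S -> agrees g S -> dtype a b = ntype g.
Proof.
move=> sp ag; have [s1 s2] := sp; have SE := agrees_supp sp ag.
apply/dtype_eqP => //; first exact: ntype_P2.
move=> k k1; rewrite -doubleMr count_ntype //.
have cpS : cycle_points g k = #|[set x in S | #|porbit c x| == k]|.
  apply: eq_card => x; rewrite !inE; case: (boolP (x \in S)) => xS /=.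
    by have [-> _] := agrees_porbit sp ag xS.
  apply/eqP => e; move: k1; rewrite -e card_porbit_gt1.
  by case: ag => _ ->; rewrite ?eqxx.
rewrite -addnn {1}cpS cpS -[X in _ = _ + X](card_imset _ (can_inj aK)).
rewrite -cardsUI (_ : _ :&: _ = set0) ?cards0 ?addn0; last first.
  apply/eqP; rewrite -subset0; apply/subsetP => x; rewrite !inE.
  case/andP=> /andP[xS _] /imsetP[y]; rewrite inE => /andP[yS _] e.
  by move: xS; rewrite e s2 ?yS // s1.
apply: eq_card => x; rewrite in_setU -[x in _ || (x \in _)]aK.
rewrite (mem_imset _ _ (can_inj aK)) !inE card_fpf_porbit // -/c.
case: (#|porbit c x| =P k) => e; last by rewrite !andbF.
by rewrite !andbT s2 ?orbN // -card_porbit_gt1 e.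
Qed.

Lemma agrees_conj g S : splits S -> agrees g S -> (a ^ g = b)%g.
Proof.
case=> s1 s2 [g1 g2]; apply/eqP/conjg_eqP => x.
have [cx|cx] := eqVneq (c x) x.
  have ab : a x = b x by rewrite -[in RHS]cx permM bK.
  have nS y : c y = y -> y \notin S by move=> e; apply/negP => /s1; rewrite e eqxx.
  by rewrite !g2 ?nS // permM aK ab.
case: (boolP (x \in S)) => xS; have := s2 _ cx; rewrite xS => h.
  by rewrite (g1 x) // g2 ?h // permM bK.
by rewrite (g2 x) // g1 ?h // permM aK.
Qed.

(** The bounds on [touched] become equalities, so each touched edge has one moved endpoint. If [x]
    is moved, [a x] is fixed, and conjugation at [a x] gives [g x = b (a x) = c x]. *)
Lemma top_agrees g : (a ^ g = b)%g -> sumn (dtype a b) = sumn (ntype g) ->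
  splits [set x | g x != x] /\ agrees g [set x | g x != x].
Proof.
move=> gab; rewrite sumn_ntype => hj.
have [R aR] := half_system ha; rewrite -(card_discrepancy ha hb aR) in hj.
have JT := discrepancy_touched R gab.
have le := card_touched_le aR g; rewrite -hj in le.
have JE : discrepancy a b R = touched a R g by apply/eqP; rewrite eqEcard JT le.
have tf : forall x, g x != x -> g (a x) = a x.
  by apply: (touched_full ha aR); rewrite -JE.
have cg x : g x != x -> c x = g x.
  move=> gx; have /eqP/conjg_eqP/(_ (a x)) := gab.
  by rewrite aK tf // permM => ->.
split; split=> x; rewrite !inE.
- by move=> gx; rewrite cg.
- move=> cx; apply/idP/idP => [h|]; first by rewrite negbK -[x]aK tf ?aK // eqxx.
  rewrite negbK => /eqP gx.
  have : x \in doubled a (discrepancy a b R).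
    by rewrite doubled_discrepancy // inE -(inj_eq (can_inj bK)) bK -(permM a b).
  rewrite mem_doubled // JE !inE !aK gx eqxx /= .
  by case/orP=> /andP[_]; rewrite ?orbF.
- by move/cg.
- by rewrite negbK => /eqP.
Qed.

Definition rep (x : T) : T := odflt x [pick y in ucomp a b x].

Lemma rep_mem x : rep x \in ucomp a b x.
Proof. by rewrite /rep; case: pickP => // /(_ x); rewrite ucomp_id. Qed.

Lemma rep_eq x y : ucomp a b x = ucomp a b y -> rep x = rep y.
Proof.
by rewrite /rep => ->; case: pickP => // /(_ y); rewrite ucomp_id.
Qed.

Lemma ucomp_rep x : ucomp a b (rep x) = ucomp a b x.
Proof. exact: ucompE (rep_mem x). Qed.

Lemma moved_ucomp x y : ucomp a b x = ucomp a b y -> (c x != x) = (c y != y).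
Proof.
by move=> e; rewrite -!card_porbit_gt1 -[LHS]ltn_double -[RHS]ltn_double -!card_ucomp // e.
Qed.

(** One point for each nontrivial component. *)
Definition reps : {set T} := [set x | (c x != x) && (rep x == x)].

Lemma card_reps : #|reps| = size (dtype a b).
Proof.
rewrite size_map size_sort size_map.
have inj : {in reps &, injective (ucomp a b)}.
  move=> x y; rewrite !inE => /andP[_ /eqP rx] /andP[_ /eqP ry] e.
  by rewrite -rx -ry; apply: rep_eq.
rewrite -(card_in_imset inj) cardE /enum_mem !size_filter count_filter.
apply: eq_count => C /=.
apply/imsetP/andP => [[x]|[C2 /imsetP[x _ e]]].
  by rewrite inE => /andP[cx _] ->; rewrite card_ucomp // (ltn_double 1) card_porbit_gt1 imset_f.
exists (rep x); last by rewrite ucomp_rep.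
rewrite inE (rep_eq (ucomp_rep x)) eqxx andbT (moved_ucomp (ucomp_rep x)).
by rewrite -card_porbit_gt1 -(ltn_double 1) -(card_ucomp ha hb) -e.
Qed.

(* The cycle of the representative of a component is chosen when the
   representative is in [Q], the opposite cycle otherwise. *)
Definition half_of (Q : {set T}) : {set T} :=
  [set x | (c x != x) && ((x \in porbit c (rep x)) == (rep x \in Q))].

Lemma half_of_splits Q : splits (half_of Q).
Proof.
split=> x; rewrite !inE; first by case/andP.
move=> cx; have e := ucompa b ha x; rewrite (moved_ucomp e) cx (rep_eq e) /=.
have h : x \in ucomp a b (rep x) by rewrite ucomp_rep // ucomp_id.
suff -> : (a x \in porbit c (rep x)) = ~~ (x \in porbit c (rep x)).
  by case: (_ \in Q); case: (x \in _).
move: h; rewrite inE => /orP[] h.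
  rewrite h /=; apply/negP; rewrite -(porbit_eq h).
  by apply/negP; exact: fpf_porbit_notin.
have h' : a x \in porbit c (rep x) by rewrite -(fpf_porbit ha hb) aK.
rewrite h' -(porbit_eq h'); apply/esym.
by have := fpf_porbit_notin ha hb (a x); rewrite aK.
Qed.

(** Such an [S] is a union of cycles of [c], one from each nontrivial component, so the
    representatives in [S] determine it. *)
Lemma splits_half_of g S : splits S -> agrees g S -> S = half_of (reps :&: S).
Proof.
move=> sp ag; have [s1 s2] := sp.
have [h1 h2] := half_of_splits (reps :&: S).
have pS x y : y \in porbit c x -> (y \in S) = (x \in S).
  move=> yx; apply/idP/idP => h.
    have [_ /subsetP] := agrees_porbit sp ag h; apply.
    by rewrite porbit_sym.
  by have [_ /subsetP] := agrees_porbit sp ag h; apply.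
apply/setP => x; case: (boolP (c x != x)) => [cx|cx]; last first.
  by rewrite !inE (negbTE cx); apply: contraNF cx => /s1.
have rr : rep x \in reps.
  by rewrite inE (rep_eq (ucomp_rep x)) eqxx andbT (moved_ucomp (ucomp_rep x)).
rewrite inE cx inE rr /=.
have : x \in ucomp a b (rep x) by rewrite ucomp_rep // ucomp_id.
case: (boolP (x \in porbit c (rep x))) => [h _|h].
  by rewrite (pS _ _ h).
rewrite inE (negbTE h) /= => h'; rewrite (pS _ _ h') s2 //.
by move: rr; rewrite inE => /andP[].
Qed.

Lemma splits_perm Q : exists g, agrees g (half_of Q).
Proof.
have [s1 s2] := half_of_splits Q.
have SC x : (c x \in half_of Q) = (x \in half_of Q).
  have h := mem_porbit c 1 x; rewrite expg1 in h.
  have e := ucomp_porbit ha hb h.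
  rewrite !inE (rep_eq e) (inj_eq perm_inj); congr (_ && (_ == _)).
  by rewrite -!eq_porbit_mem (porbit_eq h).
pose f x := if x \in half_of Q then c x else x.
have fi : injective f.
  move=> x y; rewrite /f; case: ifP => hx; case: ifP => hy //; first exact: perm_inj.
    by move=> e; move: hy; rewrite -e SC hx.
  by move=> e; move: hx; rewrite e SC hy.
by exists (perm fi); split=> x h; rewrite permE /f ?h // (negbTE h).
Qed.

(** The permutations counted correspond to subsets of [reps], through the representatives that they
    move. *)
Lemma pcount_top mu : isP2 mu -> sumn (dtype a b) = sumn mu ->
  pcount a b mu = if dtype a b == mu then 2 ^ size mu else 0.
Proof.
move=> hmu hj; case: eqP => [e|ne]; last first.
  apply: eq_card0 => g; rewrite inE; apply/negP => /andP[/eqP gn /eqP gc].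
  rewrite -gn in hj; have [sp ag] := top_agrees gc hj.
  by apply: ne; rewrite -gn; apply: agrees_dtype sp ag.
rewrite /pcount -e -card_reps -card_powerset.
pose F (g : {perm T}) := reps :&: [set x | g x != x].
set A := [set _ | _].
have AP g : g \in A -> splits [set x | g x != x] /\ agrees g [set x | g x != x].
  by rewrite inE => /andP[/eqP gn /eqP gc]; apply: top_agrees => //; rewrite gn.
have Finj : {in A &, injective F}.
  move=> g h /AP[sg ag] /AP[sh ah] eF.
  have eS : [set x | g x != x] = [set x | h x != x].
    by rewrite (splits_half_of sg ag) (splits_half_of sh ah) -/(F g) eF.
  rewrite eS in ag; case: ag ah => [g1 g2] [h1 h2]; apply/permP => x.
  by case: (boolP (x \in [set x | h x != x])) => hx; [rewrite g1 ?h1|rewrite g2 ?h2].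
rewrite -(card_in_imset Finj); apply: eq_card => Q; rewrite inE.
apply/imsetP/idP => [[g _ ->]|QW]; first exact: subsetIl.
have sp := half_of_splits Q; have [g ag] := splits_perm Q.
exists g.
  by rewrite inE -(agrees_dtype sp ag) eqxx (agrees_conj sp ag) eqxx.
rewrite /F -(agrees_supp sp ag); apply/setP => x; rewrite in_setI.
case: (boolP (x \in reps)) => [|xr] /=; last first.
  by apply: contraNF xr; apply: (subsetP QW).
rewrite inE => /andP[cx /eqP rx]; rewrite inE cx rx porbit_id /=.
by case: (x \in Q).
Qed.

End HalfSupport.

(** * Binomial inversion *)

Lemma bin_trinomial n r s : s <= r -> r <= n ->
  'C(n, r) * 'C(r, s) = 'C(n, s) * 'C(n - s, r - s).
Proof.
move=> sr rn.
have e1 := bin_fact rn; have e2 := bin_fact sr.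
have e3 := bin_fact (leq_trans sr rn); have e4 := bin_fact (leq_sub2r s rn).
rewrite (_ : n - s - (r - s) = n - r) in e4; last by rewrite subnBA // subnK // (leq_trans sr).
apply/eqP; rewrite -(eqn_pmul2r (fact_gt0 s)) -(eqn_pmul2r (fact_gt0 (r - s))).
rewrite -(eqn_pmul2r (fact_gt0 (n - r))); apply/eqP.
transitivity n`!; first by rewrite -e1 -e2; nia.
by rewrite -e3 -e4; nia.
Qed.

Section Numeric.
Local Open Scope ring_scope.
Variable K : comPzRingType.

Lemma sum_alt_bin m :
  \sum_(i < m.+1) (-1) ^+ (m - i) * ('C(m, i))%:R = (m == 0%N)%:R :> K.
Proof.
transitivity ((-1 + 1 : K) ^+ m).
  rewrite exprDn; apply: eq_bigr => i _.
  by rewrite expr1n mulr1 mulr_natr.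
by rewrite addNr expr0n.
Qed.

(** By [bin_trinomial] the inner sum is ['C(n - t, r - t)] times an alternating sum of the binomials
    ['C(r - t, s - t)], so it is 1 for [r = t] and 0 otherwise. *)
Lemma alt_bin_collapse n t lo k : (lo <= t < k)%N -> (k <= n)%N ->
  \sum_(lo <= r < k) \sum_(lo <= s < r.+1)
    (-1) ^+ (r - s) * ('C(n - s, r - s))%:R * ((t <= s) * 'C(n - t, s - t))%:R = 1 :> K.
Proof.
case/andP=> lot tk kn.
rewrite (eq_big_nat _ _ (F2 := fun r => (r == t)%:R)).
  rewrite (big_cat_nat lot (ltnW tk)) /= big_nat big1 ?add0r; last first.
    by move=> r /andP[_ h]; rewrite ltn_eqF.
  rewrite big_ltn // eqxx big_nat big1 ?addr0 // => r /andP[h _].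
  by rewrite gtn_eqF.
move=> r /andP[lor rk].
case: (ltnP r t) => [rt|tr].
  rewrite ltn_eqF // big_nat big1 // => s /andP[_ sr].
  by rewrite leqNgt (leq_ltn_trans _ rt) // mul0n mulr0.
rewrite (big_cat_nat lot (leqW tr)) /= big_nat big1 ?add0r; last first.
  by move=> s /andP[_ h]; rewrite leqNgt h mul0n mulr0.
rewrite -{1}[t]add0n big_addn subSn // big_mkord.
transitivity ('C(n - t, r - t)%:R * \sum_(i < (r - t).+1) (-1) ^+ (r - t - i) * 'C(r - t, i)%:R : K).
  rewrite big_distrr; apply: eq_bigr => i _ /=.
  have ir : (i <= r - t)%N by rewrite -ltnS.
  rewrite leq_addl mul1n addnK mulrCA -mulrA -!natrM (addnC i) !subnDA.
  by rewrite mulnC -bin_trinomial // leq_sub2r // ltnW // (leq_trans rk).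
rewrite sum_alt_bin subn_eq0 [r == t]eqn_leq tr andbT.
by case: leqP => h; rewrite ?mulr0 // mulr1 (_ : r - t = 0)%N ?bin0 //; apply/eqP; rewrite subn_eq0.
Qed.
End Numeric.

(** For [j < k], the 1 contributed by each [g] is expanded by [alt_bin_collapse] with
    [t = #|touched a H g|]; after exchanging sums, [touched_count] evaluates the sum over [g]. *)
Lemma dcoefE (R : realType) (T : finType) (a b : {perm T}) mu n :
  #|T| = n.*2 -> fpf a -> fpf b -> isP2 mu -> sumn mu <= n ->
  dcoef R mu n (dtype a b) = ((pcount a b mu)%:R)%R.
Proof.
move=> Tn ha hb hmu hk.
have [H aH] := half_system ha.
have Hn : #|H| = n by apply: double_inj; rewrite -Tn (card_half_system ha aH).
have cJ := card_discrepancy ha hb aH.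
have okP g : (ntype g == mu) && (a ^ g == b)%g ->
    [/\ sumn (dtype a b) <= #|touched a H g|, #|touched a H g| <= sumn mu,
        sumn mu <= #|touched a H g|.*2 &
        sumn (dtype a b) < sumn mu -> #|touched a H g| < sumn mu].
  case/andP=> /eqP <- /eqP gc; rewrite -cJ sumn_ntype; split.
  - exact/subset_leq_card/discrepancy_touched.
  - exact: card_touched_le.
  - exact: card_touched_ge.
  - exact: touched_lt.
rewrite /dcoef; case: ltnP => [kj|jk].
  rewrite /pcount eq_card0 // => g; rewrite inE; apply/negP => /okP[h1 h2 _ _].
  by move: kj; rewrite ltnNge (leq_trans h1 h2).
case: eqP => [e|/eqP ne]; first by rewrite pcount_top //; case: eqP; rewrite ?natrX.
have {ne}jk : sumn (dtype a b) < sumn mu by rewrite ltn_neqAle ne.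
set j := sumn _ in jk okP cJ *; set k := sumn mu in okP jk hk *; set lo := maxn _ _.
pose F (r s t : nat) : R[i]%C :=
  ((-1) ^+ (r - s) * ('C(n - s, r - s))%:R * ((t <= s) * 'C(n - t, s - t))%:R)%R.
transitivity (\sum_(g : {perm T} | (ntype g == mu) && (a ^ g == b)%g)
   \sum_(lo <= r < k) \sum_(lo <= s < r.+1) F r s #|touched a H g|)%R; last first.
  rewrite (eq_bigr (fun=> 1%R)); last first.
    (* The limits of summation come from here: [j <= t] and [k <= 2t] give the lower one, [t < k]
       the upper one. *)
    move=> g /okP[h1 h2 h3 h4]; apply: alt_bin_collapse => //.
    rewrite h4 // andbT /lo geq_max h1 /=; lia.
  by rewrite sumr_const /pcount -[in RHS]cardsE; congr (_ *+ _)%R; apply: eq_card => g; rewrite !inE.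
rewrite exchange_big /=; apply: eq_big_nat => r /andP[lor rk].
rewrite exchange_big /= big_distrl /=; apply: eq_big_nat => s /andP[los sr].
have js : j <= s by apply: leq_trans los; rewrite leq_maxl.
rewrite -big_distrr /= -natr_sum -Hn -touched_count // Hn.
have sr' : s <= r by rewrite -ltnS.
(* This trades ['C(n - j, s - j) * 'C(n - s, r - s)] for ['C(n - j, r - j) * 'C(r - j, s - j)]. *)
have := @bin_trinomial (n - j) (r - j) (s - j).
rewrite leq_sub2r // leq_sub2r ?(leq_trans (ltnW rk)) // => /(_ isT isT).
rewrite !subnBA // !subnK ?(leq_trans js sr') ?(leq_trans (ltnW jk) hk) // => tri.
rewrite -!mulrA -!natrM; congr (_ * _%:R)%R.
by rewrite mulnCA [X in _ * X]mulnC tri [X in _ * X]mulnC mulnC mulnA.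
Qed.

(** * Existence of pairs of matchings *)

Lemma cycle_pointsE (T : finType) (g : {perm T}) k :
  cycle_points g k = \sum_(x : T) (#|porbit g x| == k).
Proof.
rewrite /cycle_points -sum1_card big_mkcond; apply: eq_bigr => x _.
by rewrite inE; case: eqP.
Qed.

Lemma cycle_points_sum (T T' : finType) (g : {perm T}) (h : {perm T'}) :
  exists f : {perm T + T'}, forall k, cycle_points f k = cycle_points g k + cycle_points h k.
Proof.
pose F u := match u with inl x => inl (g x) | inr y => inr (h y) end.
have Fi : injective F by move=> [x|y] [x'|y'] // [/perm_inj ->].
exists (perm Fi) => k; rewrite !cycle_pointsE big_sumType /=.
have inlI : injective (@inl T T') by move=> x y [].
have inrI : injective (@inr T T') by move=> x y [].
congr (_ + _); apply: eq_bigr => x _.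
  by rewrite (porbit_embed (g' := g)) ?card_imset // => z; rewrite permE.
by rewrite (porbit_embed (g' := h)) ?card_imset // => z; rewrite permE.
Qed.

Lemma cycle_points_rot n :
  exists f : {perm 'I_n.+1}, forall k, cycle_points f k = (n.+1 == k) * k.
Proof.
have oi : injective (@ordS n.+1) by exact: can_inj (@ordSK _).
exists (perm oi) => k.
have full x : porbit (perm oi) x = setT.
  have it i : ((perm oi ^+ i)%g x : nat) = (x + i) %% n.+1.
    elim: i => [|i IH]; first by rewrite expg0 perm1 addn0 modn_small.
    by rewrite expgSr permM permE /= IH -[X in X %% _]addn1 modnDml addn1 addnS.
  apply/setP => y; rewrite inE; apply/porbitP; exists (y + (n.+1 - x)).
  apply: val_inj; rewrite /= it addnCA subnKC; last by rewrite ltnW.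
  by rewrite modnDr modn_small.
rewrite cycle_pointsE (eq_bigr (fun=> n.+1 == k : nat)); last first.
  by move=> x _; rewrite full cardsT card_ord.
by rewrite sum_nat_const card_ord mulnC; case: eqP => [->|]; rewrite ?mul0n.
Qed.

(** A disjoint union of rotations, one for each part. *)
Lemma cycle_type_exists (s : seq nat) : all (leq 1) s ->
  exists (T : finType) (g : {perm T}),
    #|T| = sumn s /\ forall k, cycle_points g k = count_mem k s * k.
Proof.
elim: s => [|[|n] s IH] //= => [_|/IH[T [g [cT hg]]]].
  exists 'I_0, 1%g; split; first by rewrite card_ord.
  by move=> k; rewrite cycle_pointsE big_ord0.
have [r hr] := cycle_points_rot n; have [f hf] := cycle_points_sum r g.
exists ('I_n.+1 + T)%type, f; split; first by rewrite card_sum card_ord cT.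
by move=> k; rewrite hf hr hg mulnDl.
Qed.

Lemma ntype_exists (T : finType) mu : isP2 mu -> sumn mu <= #|T| ->
  exists g : {perm T}, ntype g = mu.
Proof.
move=> hmu le; have [|T' [g [cT' hg]]] := @cycle_type_exists (pad mu #|T|).
  rewrite all_cat all_nseq /= orbT andbT.
  by case/andP: hmu => _; apply: sub_all => x /ltnW.
have e : #|T'| = #|T|.
  by rewrite cT' sumn_cat sumn_nseq mul1n subnKC.
pose phi (x : T') : T := enum_val (cast_ord e (enum_rank x)).
have phi_inj : injective phi by move=> x y /enum_val_inj/cast_ord_inj/enum_rank_inj.
have [f [f1 f2]] := perm_extend phi_inj g.
exists f; rewrite (ntype_embed phi_inj f1 f2); apply/ntype_eqP => // k k1.
rewrite hg count_cat (_ : count_mem k (nseq _ _) = 0) ?addn0 //.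
by rewrite count_nseq /=; case: eqP k1 => // <-.
Qed.

(** Since [g] moves at most one endpoint of each edge, [a * a ^ g] agrees with [g] on the support of
    [g], and [agrees_dtype] applies. *)
Lemma dtype_half_conj (T : finType) (a g : {perm T}) (H : {set T}) : fpf a ->
  (forall x, (a x \in H) = (x \notin H)) -> perm_on H g -> dtype a (a ^ g) = ntype g.
Proof.
move=> ha aH gH; have hb := fpfJ g ha; have aK := fpfK ha.
have tf x : g x != x -> g (a x) = a x.
  by move=> gx; apply: (out_perm gH); rewrite aH negbK; apply: contraR gx => /(out_perm gH) ->.
have cg x : g x != x -> (a * a ^ g)%g x = g x.
  by move=> gx; rewrite permM -(tf x gx) permJ aK.
apply: (agrees_dtype ha hb (S := [set x | g x != x])); split=> x; rewrite !inE.
- by move=> gx; rewrite cg.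
- move=> cx; apply/idP/idP => [h|]; first by rewrite negbK -[x]aK tf ?aK // eqxx.
  rewrite negbK => /eqP gx; apply: contra cx => /eqP gax.
  by rewrite permM -{1}gax permJ aK gx.
- by move/cg.
- by rewrite negbK => /eqP.
Qed.

Lemma dist_exists n tau : isP2 tau -> sumn tau <= n ->
  exists A B : matching n.*2, dtype (mate A) (mate B) = tau.
Proof.
move=> ht le; pose A : matching n.*2 := Sub (I_raw n) (I_raw_pm n).
have [H aH] := half_system (mate_fpf A).
have cH : #|H| = n.
  by apply: double_inj; rewrite -(card_half_system (mate_fpf A) aH) card_ord.
have [|g hg] := @ntype_exists {x | x \in H} tau ht; first by rewrite card_sig cH.
have [f [f1 f2]] := perm_extend val_inj g.
have fH : perm_on H f.
  apply/subsetP => x; rewrite inE; apply: contraR => xH; rewrite f2 //.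
  by apply/codomP => -[u e]; move: xH; rewrite e (valP u).
have [B hB] := mate_surj (fpfJ f (mate_fpf A)).
exists A, B; rewrite hB (dtype_half_conj (mate_fpf A) aH fH) -hg.
by rewrite (ntype_embed val_inj f1 f2).
Qed.

(** * Operators *)

Lemma mem_words k b w : (w \in words k b) = (size w == k) && all (leq^~ b) w.
Proof.
elim: k w => [|k IH] w; first by rewrite inE; case: w.
case: w => [|x w]; first by apply/negbTE/negP; case/allpairsPdep => y [v []].
rewrite eqSS; apply/allpairsPdep/and3P => [[y [v [hy hv [-> ->]]]]|[h1 h2 h3]].
  by move: hv hy; rewrite IH mem_iota => /andP[h1 h2] /andP[_ h3]; split.
exists x, w; split=> //; first by rewrite mem_iota ltnS.
by rewrite IH h1; exact: h3.
Qed.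

(** Parts are positive, so the length and every part are at most [sumn mu]; the bounds on the
    enumerated words lose nothing. *)
Lemma mem_P2_enum n mu : (mu \in P2_enum n) = isP2 mu && (sumn mu <= n).
Proof.
rewrite mem_undup mem_filter; apply: andb_idr => /andP[hmu le].
have size_le : size mu <= sumn mu.
  case/andP: hmu => _; elim: mu {le} => //= x mu IH /andP[x1 /IH le].
  by apply: leq_trans (leq_add (ltnW x1) le); rewrite add1n.
apply/flattenP; exists (words (size mu) n).
  by apply/mapP; exists (size mu); rewrite // mem_iota ltnS (leq_trans size_le).
rewrite mem_words eqxx /=; apply/allP => x xmu; apply: leq_trans le.
elim: mu xmu {hmu size_le} => //= y mu IH; rewrite inE => /orP[/eqP ->|/IH h].
  exact: leq_addr.
exact: leq_trans h (leq_addl _ _).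
Qed.

Lemma P2_enum_uniq n : uniq (P2_enum n).
Proof. exact: undup_uniq. Qed.

Local Open Scope ring_scope.

Section Operators.
Variables (R : realType) (n : nat).
Local Notation C := (R[i]).
Implicit Types (A B : matching n.*2) (x : vec R n).

Lemma vecZE (z : C) x B : (z *: x) B = z * x B.
Proof. by rewrite ffunE. Qed.

Lemma vec_sumE (I : Type) (s : seq I) (P : pred I) (F : I -> vec R n) B :
  (\sum_(i <- s | P i) F i) B = \sum_(i <- s | P i) F i B.
Proof. exact: sum_ffunE. Qed.

Lemma dtype_enum A B : dtype (mate A) (mate B) \in P2_enum n.
Proof.
rewrite mem_P2_enum dtype_P2 ?mate_fpf //= -leq_double sumn_dtype ?mate_fpf //.
by rewrite -[X in (_ <= X)%N]card_ord max_card.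
Qed.

Lemma sum_P2_enum t (F : seq nat -> C) : t \in P2_enum n ->
  \sum_(tau <- P2_enum n) (if t == tau then F tau else 0) = F t.
Proof.
move=> ht; rewrite (bigD1_seq t) ?P2_enum_uniq //= eqxx big1 ?addr0 // => tau.
by rewrite eq_sym => /negbTE ->.
Qed.

Lemma f_opE mu x B : isP2 mu ->
  f_op n mu x B = \sum_A x A * (pcount (mate A) (mate B) mu)%:R.
Proof.
move=> hmu; rewrite /f_op vec_sumE.
under eq_bigr do rewrite ffunE big_mkcond.
rewrite exchange_big /=; apply: eq_bigr => A _.
rewrite -big_mkcondr sumr_const mulr_natr; congr (_ *+ _).
by apply: eq_card => g; rewrite [in RHS]inE -mact_eq -(ctype_eq _ hmu).
Qed.

Lemma M_opE tau x B : tau \in P2_enum n ->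
  M_op n tau x B = \sum_A (if dtype (mate A) (mate B) == tau then x A else 0).
Proof.
rewrite mem_P2_enum => /andP[h le]; rewrite /M_op le ffunE big_mkcond.
by apply: eq_bigr => A _; rewrite -dist_eq ?doubleK.
Qed.

Lemma dcoef_pcount mu A B : mu \in P2_enum n ->
  dcoef R mu n (dtype (mate A) (mate B)) = (pcount (mate A) (mate B) mu)%:R.
Proof.
rewrite mem_P2_enum => /andP[h le].
by rewrite dcoefE ?mate_fpf // card_ord.
Qed.

(** For each pair [(A, B)] only [tau = dtype (mate A) (mate B)] contributes, and its coefficient is
    the matrix entry of [f(mu,2n)]. *)
Lemma f_op_expansion mu x : mu \in P2_enum n ->
  f_op n mu x = \sum_(tau <- P2_enum n) dcoef R mu n tau *: M_op n tau x.
Proof.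
move=> hmu; apply/ffunP => B; rewrite f_opE; last by move: hmu; rewrite mem_P2_enum => /andP[].
rewrite vec_sumE.
rewrite (eq_big_seq (fun tau => \sum_A dcoef R mu n tau *
    (if dtype (mate A) (mate B) == tau then x A else 0))); last first.
  by move=> tau ht; rewrite vecZE M_opE // big_distrr.
rewrite exchange_big /=; apply: eq_bigr => A _.
rewrite -dcoef_pcount // mulrC.
rewrite -(sum_P2_enum (fun tau => dcoef R mu n tau * x A) (dtype_enum A B)).
by apply: eq_bigr => tau _; case: eqP; rewrite ?mulr0.
Qed.

Lemma vactE (s : {perm 'I_n.*2}) x B : vact n s x B = x (Defs.mact (s^-1)%g B).
Proof.
rewrite ffunE (big_pred1 (Defs.mact (s^-1)%g B)) // => A.
by rewrite mact_eq -[RHS](inj_eq (@mate_inj _)) mate_mact -[RHS](inj_eq (conjg_inj s)) conjgKV.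
Qed.

Lemma mactK (s : {perm 'I_n.*2}) A : Defs.mact (s^-1)%g (Defs.mact s A) = A.
Proof. by apply: mate_inj; rewrite !mate_mact conjgK. Qed.

Lemma mactKV (s : {perm 'I_n.*2}) A : Defs.mact s (Defs.mact (s^-1)%g A) = A.
Proof. by apply: mate_inj; rewrite !mate_mact conjgKV. Qed.

Lemma f_op_equivariant mu (s : {perm 'I_n.*2}) x : isP2 mu ->
  f_op n mu (vact n s x) = vact n s (f_op n mu x).
Proof.
move=> hmu; apply/ffunP => B; rewrite vactE !f_opE //.
rewrite (reindex (Defs.mact s)); last first.
  by exists (Defs.mact (s^-1)%g) => A _; rewrite ?mactK ?mactKV.
apply: eq_bigr => A _; rewrite vactE mactK; congr (_ * _%:R).
by rewrite -{1}(mactKV s B) !mate_mact pcountJ.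
Qed.

Lemma f_op_linear mu (z : C) x y : isP2 mu ->
  f_op n mu (z *: x + y) = z *: f_op n mu x + f_op n mu y.
Proof.
move=> hmu; apply/ffunP => B; rewrite !ffunE !f_opE //.
rewrite /GRing.scale /= big_distrr -big_split /=; apply: eq_bigr => A _.
by rewrite !ffunE mulrDl mulrA.
Qed.

Definition basis_vec A : vec R n := [ffun B => (B == A)%:R].

Lemma f_op_basis mu A B : mu \in P2_enum n ->
  f_op n mu (basis_vec A) B = dcoef R mu n (dtype (mate A) (mate B)).
Proof.
move=> hmu; rewrite f_opE; last by move: hmu; rewrite mem_P2_enum => /andP[].
rewrite (bigD1 A) //= ffunE eqxx mul1r dcoef_pcount // big1 ?addr0 // => A' h.
by rewrite ffunE (negbTE h) mul0r.
Qed.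

Lemma dcoef_diag mu : dcoef R mu n mu = 2 ^+ size mu.
Proof. by rewrite /dcoef ltnn !eqxx. Qed.

Lemma dcoef_triangular mu tau : (sumn mu <= sumn tau)%N -> tau != mu ->
  dcoef R mu n tau = 0.
Proof.
by rewrite /dcoef leq_eqVlt => /orP[/eqP ->|->] // /negbTE ->; rewrite ltnn eqxx.
Qed.

Lemma dcoef_diag_neq0 mu : dcoef R mu n mu != 0.
Proof. by rewrite dcoef_diag expf_neq0 // Num.Theory.pnatr_eq0. Qed.

(** Descending induction on [|mu|]: at a pair with [dtype] equal to [mu], terms with [|nu| <= |mu|]
    and [nu != mu] vanish by triangularity, larger ones by induction. *)
Lemma f_op_free (c : seq nat -> C) :
  (forall x : vec R n, \sum_(mu <- P2_enum n) c mu *: f_op n mu x = 0) ->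
  forall mu, mu \in P2_enum n -> c mu = 0.
Proof.
move=> h; suff H d mu : mu \in P2_enum n -> (n - sumn mu < d)%N -> c mu = 0.
  by move=> mu hmu; apply: (H (n - sumn mu).+1).
elim: d mu => // d IH mu hmu lt.
have [A [B AB]] : exists A B : matching n.*2, dtype (mate A) (mate B) = mu.
  by apply: dist_exists; move: hmu; rewrite mem_P2_enum => /andP[].
have /ffunP/(_ B) := h (basis_vec A); rewrite vec_sumE [in RHS]ffunE.
rewrite (bigD1_seq mu) ?P2_enum_uniq //= big_seq_cond big1 ?addr0.
  rewrite ffunE f_op_basis // AB => /eqP; rewrite mulf_eq0 (negbTE (dcoef_diag_neq0 _)) orbF.
  by move/eqP.
move=> nu /andP[hnu ne]; rewrite ffunE f_op_basis // AB.
case: (leqP (sumn nu) (sumn mu)) => [le|gt].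
  by rewrite dcoef_triangular ?[_ *: _]mulr0 // eq_sym.
rewrite IH ?scale0r //.
have : (sumn nu <= n)%N by move: hnu; rewrite mem_P2_enum => /andP[].
by move: gt lt; lia.
Qed.

(** Back substitution from the largest [|tau|] downwards. *)
Lemma triangular_solve (phi : seq nat -> C) : exists c : seq nat -> C,
  forall tau, tau \in P2_enum n ->
    phi tau = \sum_(mu <- P2_enum n) c mu * dcoef R mu n tau.
Proof.
suff H d (psi : seq nat -> C) :
    (forall tau, tau \in P2_enum n -> (d <= sumn tau)%N -> psi tau = 0) ->
    exists c : seq nat -> C, forall tau, tau \in P2_enum n ->
      psi tau = \sum_(mu <- P2_enum n) c mu * dcoef R mu n tau.
  apply: (H n.+1) => tau; rewrite mem_P2_enum => /andP[_ le].
  by rewrite ltnNge le.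
elim: d psi => [|d IH] psi h.
  exists (fun=> 0) => tau ht; rewrite h // big1 // => mu _; exact: mul0r.
(* Dividing by the diagonal entry clears size [d]; by triangularity, values at larger sizes are
   unaffected. *)
pose c1 mu : C := if sumn mu == d then psi mu / dcoef R mu n mu else 0.
have [|c2 hc2] := IH (fun tau => psi tau - \sum_(mu <- P2_enum n) c1 mu * dcoef R mu n tau).
  move=> tau ht le; rewrite (bigD1_seq tau) ?P2_enum_uniq //= big1 ?addr0.
    rewrite /c1; case: eqP => [_|ne]; first by rewrite mulfVK ?dcoef_diag_neq0 ?subrr.
    by rewrite mul0r subr0 h // ltn_neqAle le andbT eq_sym; apply/eqP.
  move=> mu ne; rewrite /c1; case: eqP => [e|]; rewrite ?mul0r //.
  by rewrite (@dcoef_triangular mu tau) ?mulr0 ?e // eq_sym.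
exists (fun mu => c1 mu + c2 mu) => tau ht.
under eq_bigr do rewrite mulrDl.
by rewrite big_split /= -hc2 // addrC subrK.
Qed.

(** * Equivariant operators lie in the span *)

Section Span.
Variable X : vec R n -> vec R n.
Hypothesis Xlin : forall (z : C) x y, X (z *: x + y) = z *: X x + X y.
Hypothesis Xact : forall (s : {perm 'I_n.*2}) x, X (vact n s x) = vact n s (X x).

Lemma linear_kernel x B : X x B = \sum_A x A * X (basis_vec A) B.
Proof.
have X0 : X 0 = 0.
  by have := Xlin (-1) 0 0; rewrite scaler0 addr0 scaleN1r addNr.
have Xsum (s : seq (matching n.*2)) :
    X (\sum_(A <- s) x A *: basis_vec A) = \sum_(A <- s) x A *: X (basis_vec A).
  by elim: s => [|A s IH]; rewrite ?big_nil // !big_cons Xlin IH.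
have {1}-> : x = \sum_A x A *: basis_vec A.
  apply/ffunP => A; rewrite vec_sumE (bigD1 A) //= big1 ?addr0.
    by rewrite vecZE ffunE eqxx mulr1.
  by move=> A' ne; rewrite vecZE ffunE eq_sym (negbTE ne) mulr0.
by rewrite Xsum vec_sumE; apply: eq_bigr => A _; rewrite vecZE.
Qed.

Lemma kernel_invariant (s : {perm 'I_n.*2}) A B :
  X (basis_vec (Defs.mact s A)) (Defs.mact s B) = X (basis_vec A) B.
Proof.
have -> : basis_vec (Defs.mact s A) = vact n s (basis_vec A).
  apply/ffunP => B'; rewrite vactE !ffunE; congr (_%:R : C); congr (nat_of_bool _).
  by apply/eqP/eqP => [->|<-]; rewrite ?mactK ?mactKV.
by rewrite Xact vactE mactK.
Qed.

(** [phi] reads the entry at an arbitrary pair of the given type. By [pair_conj] all such pairs are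
    conjugate, and the entries are invariant. *)
Lemma kernel_dtype : exists phi : seq nat -> C, forall A B,
  X (basis_vec A) B = phi (dtype (mate A) (mate B)).
Proof.
exists (fun tau => if [pick p : matching n.*2 * matching n.*2 |
    dtype (mate p.1) (mate p.2) == tau] is Some p then X (basis_vec p.1) p.2 else 0).
move=> A B; case: pickP => [[A' B'] /= /eqP e|/(_ (A, B))]; last by rewrite eqxx.
have [s [sA sB]] := pair_conj (mate_fpf A') (mate_fpf B') (mate_fpf A) (mate_fpf B) e.
have -> : A = Defs.mact s A' by apply: mate_inj; rewrite mate_mact.
have -> : B = Defs.mact s B' by apply: mate_inj; rewrite mate_mact.
exact: kernel_invariant.
Qed.

Lemma f_op_span : exists c : seq nat -> C,
  forall x, X x = \sum_(mu <- P2_enum n) c mu *: f_op n mu x.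
Proof.
have [phi hphi] := kernel_dtype; have [c hc] := triangular_solve phi.
exists c => x; apply/ffunP => B; rewrite linear_kernel vec_sumE.
rewrite (eq_big_seq (fun mu => \sum_A x A *
    (c mu * dcoef R mu n (dtype (mate A) (mate B))))); last first.
  move=> mu hmu; rewrite vecZE f_opE; last first.
    by move: hmu; rewrite mem_P2_enum => /andP[].
  by rewrite big_distrr; apply: eq_bigr => A _; rewrite dcoef_pcount // mulrCA.
rewrite exchange_big /=; apply: eq_bigr => A _.
by rewrite hphi hc ?dtype_enum // big_distrr.
Qed.

End Span.

End Operators.

Theorem theorem3p3 (R : realType) :
  (* (i) the expansion f(mu,2n) = \sum_{tau in P(2,n)} d^tau_mu(2n) M_{2tau}(2n),
         with d^tau_mu(2n) given by the stated formula (dcoef) *)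
  (forall (mu : seq nat) (n : nat),
      isP2 mu -> (sumn mu <= n)%N ->
      forall x : vec R n,
        f_op n mu x = \sum_(tau <- P2_enum n) dcoef R mu n tau *: M_op n tau x)
  /\
  (* (ii) {f(mu,2n) : mu in P(2,n)} is a basis of B_2n = End_{S_2n}(C[M_2n]) *)
  (forall n : nat,
      (* each f(mu,2n) lies in B_2n: it is linear and commutes with S_2n *)
      (forall mu, mu \in P2_enum n ->
         (forall (a : R[i]) (x y : vec R n),
             f_op n mu (a *: x + y) = a *: f_op n mu x + f_op n mu y) /\
         (forall (s : {perm 'I_(n.*2)}) (x : vec R n),
             f_op n mu (vact n s x) = vact n s (f_op n mu x)))
      /\
      (* linear independence *)
      (forall c : seq nat -> R[i],
         (forall x : vec R n, \sum_(mu <- P2_enum n) c mu *: f_op n mu x = 0) ->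
         forall mu, mu \in P2_enum n -> c mu = 0)
      /\
      (* spanning B_2n *)
      (forall X : vec R n -> vec R n,
         (forall (a : R[i]) (x y : vec R n), X (a *: x + y) = a *: X x + X y) ->
         (forall (s : {perm 'I_(n.*2)}) (x : vec R n), X (vact n s x) = vact n s (X x)) ->
         exists c : seq nat -> R[i],
           forall x : vec R n, X x = \sum_(mu <- P2_enum n) c mu *: f_op n mu x)).
Proof.
split=> [mu n hmu le x|n]; first by apply: f_op_expansion; rewrite mem_P2_enum hmu.
split.
  move=> mu; rewrite mem_P2_enum => /andP[hmu _].
  by split=> *; [apply: f_op_linear|apply: f_op_equivariant].
by split; [apply: f_op_free|apply: f_op_span].
Qed.
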